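(* Let $\varepsilon\in\{1,-1\}$ and let $n$ be an integer with $n\ge 6$ if $\varepsilon=1$ and $n\ge 7$ if $\varepsilon=-1$. Let $\Theta$ be a connected graph such that for every vertex $v$ of $\Theta$ the subgraph induced on the set of neighbours of $v$ is isomorphic to $\Sigma^\varepsilon_n$. Then $\Theta\cong\Sigma^\varepsilon_{n+1}$.
   Context: Graphs are undirected, without loops or multiple edges. For $m\ge 1$ and $\varepsilon\in\{1,-1\}$, let $T_m$ be an $m$-dimensional vector space over $\mathrm{GF}(3)$ carrying a nondegenerate symmetric bilinear form $(\cdot,\cdot)$ whose discriminant is $\varepsilon$ (modulo squares). A point $\langle v\rangle$ of $T_m$ is of type $(+)$ if $(v,v)=1$. The graph $\Sigma^\varepsilon_m$ has as vertices the $(+)$-points of $T_m$, two vertices being adjacent iff they are perpendicular with respect to the form. *)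

(* Defs.v *)
From HB Require Import structures.
From mathcomp Require Import all_boot all_order all_algebra.
From Stdlib Require Import Relations.
Set Implicit Arguments. Unset Strict Implicit. Unset Printing Implicit Defensive.
Import GRing.Theory.
Local Open Scope ring_scope.

Notation F3 := 'F_3.

Definition bform (m : nat) (B : 'M[F3]_m) (u v : 'rV[F3]_m) : F3 :=
  (u *m B *m v^T) 0 0.

(* A symmetric nondegenerate bilinear form of discriminant eps (modulo squares).
   The nonzero squares of GF(3) are {1}, so "discriminant eps mod squares"
   means det B = eps exactly in GF(3). det B <> 0 gives nondegeneracy. *)
Definition good_form (m : nat) (eps : int) (B : 'M[F3]_m) : Prop :=
  B^T = B /\ \det B = eps%:~R.

Definition span1 (m : nat) (v : 'rV[F3]_m) : {set 'rV[F3]_m} :=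
  [set a *: v | a : F3].

Definition plus_point (m : nat) (B : 'M[F3]_m) (S : {set 'rV[F3]_m}) : bool :=
  [exists v, (S == span1 v) && (bform B v v == 1)].

Definition SigmaV (m : nat) (B : 'M[F3]_m) := {S : {set 'rV[F3]_m} | plus_point B S}.

Definition SigmaAdj (m : nat) (B : 'M[F3]_m) (S T : SigmaV B) : Prop :=
  forall u v, u \in val S -> v \in val T -> bform B u v = 0.

Definition graph_iso (V1 V2 : Type) (e1 : V1 -> V1 -> Prop) (e2 : V2 -> V2 -> Prop) : Prop :=
  exists f : V1 -> V2, bijective f /\ forall x y, e1 x y <-> e2 (f x) (f y).

(* A graph (V, e) is isomorphic to Sigma^eps_m (for some, equivalently every,
   nondegenerate symmetric form of discriminant eps on GF(3)^m). *)
Definition iso_Sigma (V : Type) (e : V -> V -> Prop) (eps : int) (m : nat) : Prop :=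
  exists B : 'M[F3]_m, good_form eps B /\ graph_iso e (@SigmaAdj m B).

Definition simple_graph (V : Type) (e : V -> V -> Prop) : Prop :=
  (forall x y, e x y -> e y x) /\ (forall x, ~ e x x).

Definition connected_graph (V : Type) (e : V -> V -> Prop) : Prop :=
  inhabited V /\ forall x y, clos_refl_trans V e x y.

Definition nbhd (V : Type) (e : V -> V -> Prop) (v : V) := {w : V | e v w}.
Definition nbhd_adj (V : Type) (e : V -> V -> Prop) (v : V)
  (x y : nbhd e v) : Prop := e (proj1_sig x) (proj1_sig y).

(* Main.v *)
Require Import Defs.
From Stdlib Require Import Relations.
From mathcomp Require Import zify.
From mathcomp Require Import all_boot all_order all_algebra.
From mathcomp Require Import boolp.
Set Implicit Arguments. Unset Strict Implicit. Unset Printing Implicit Defensive.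
Import GRing.Theory.
Local Open Scope ring_scope.

(* Write T(x) for the quadratic space attached to the neighbourhood of x; a point has norm 1.  Two nonadjacent points
   a, b of Sigma, scaled so that (a,b) = 1, span a degenerate plane with radical a - b, and their common neighbours are
   the points of a^perp orthogonal to the isotropic vector a - b.  Hence, if y is at distance 2 from x, every common
   neighbour z of x and y singles out an isotropic r_z in T(x) such that the common neighbours of x, y, z are the points
   of T(x) orthogonal to z and r_z.  Adjacent z give the same r_z, and the points of r^perp form a connected graph (this
   is where the bounds on n enter), so the common neighbours of x and y are exactly the points of r^perp.  It follows
   that Theta has diameter 2 and that every isotropic line <r> of T(x) comes from exactly two vertices, the "twins"
   x + r and x - r of the model Sigma_{n+1} in <x> + T(x).  It remains to choose signs: adjacency among the vertices at
   distance 2 gives a form which agrees up to sign with (r, r').  The sign is a cocycle on triples of pairwise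
   nonorthogonal isotropic vectors, because such a triple has a common neighbour z and can be compared with the known
   space T(z) through the root r - (r,r')r' of the hyperbolic plane <r, r'>.  The graph of nonorthogonality on isotropic
   vectors is simply connected with respect to triangles, so the cocycle is a coboundary. *)

(** * Quadratic forms over GF(3) *)

Lemma F3_elim (P : F3 -> Prop) : P 0 -> P 1 -> P (-1) -> forall a, P a.
Proof.
move=> P0 P1 Pm a; have : a \in [:: 0; 1; -1] by case: a => [[|[|[|]]]].
by rewrite !inE => /or3P[] /eqP->.
Qed.

Ltac f3close :=
  lazymatch goal with
  | |- _ /\ _ => split; f3close
  | |- _ <-> _ => split; f3close
  | |- _ \/ _ => solve [left; f3close | right; f3close]
  | |- is_true _ -> _ => let H := fresh in intro H; first [exfalso; clear -H; vm_compute in H; discriminate H | clear H; f3close]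
  | |- @eq bool _ _ -> _ => let H := fresh in intro H; first [exfalso; clear -H; vm_compute in H; discriminate H | clear H; f3close]
  | |- _ = _ -> _ => let H := fresh in intro H; first [exfalso; clear -H; move/eqP: H => H; vm_compute in H; discriminate H | clear H; f3close]
  | |- _ \/ _ -> _ => case; f3close
  | |- _ /\ _ -> _ => case; f3close
  | |- ~ _ => let H := fresh in intro H; exfalso; clear -H; move/eqP: H => H; vm_compute in H; discriminate H
  | |- _ = _ => apply/eqP; vm_compute; reflexivity
  | |- is_true _ => vm_compute; reflexivity
  | |- _ => solve [done | intro; f3close]
  end.

(* Decides a statement about GF(3) whose atoms are scalars and values of bilinear forms. *)
Ltac f3 :=
  repeat match goal with
  | |- context [bform ?B ?u ?v] => generalize (bform B u v)
  end;
  let rec go := lazymatch goal with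
  | |- forall x : ordinal _, _ => elim/F3_elim; go
  | |- forall x : GRing.PzSemiRing.sort _, _ => elim/F3_elim; go
  | |- forall x : GRing.PzRing.sort _, _ => elim/F3_elim; go
  | |- _ => f3close
  end in go.

Section BilinearForm.
Variables (n : nat) (B : 'M[F3]_n).
Implicit Types (u v w : 'rV[F3]_n).

Lemma bformDl u v w : bform B (u + v) w = bform B u w + bform B v w.
Proof. by rewrite /bform !mulmxDl mxE. Qed.

Lemma bformZl a u v : bform B (a *: u) v = a * bform B u v.
Proof. by rewrite /bform -!scalemxAl mxE. Qed.

Lemma bformDr u v w : bform B u (v + w) = bform B u v + bform B u w.
Proof. by rewrite /bform linearD /= mulmxDr mxE. Qed.

Lemma bformZr a u v : bform B u (a *: v) = a * bform B u v.
Proof. by rewrite /bform linearZ /= -scalemxAr mxE. Qed.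

Lemma bformNl u v : bform B (- u) v = - bform B u v.
Proof. by rewrite -scaleN1r bformZl mulN1r. Qed.

Lemma bformNr u v : bform B u (- v) = - bform B u v.
Proof. by rewrite -scaleN1r bformZr mulN1r. Qed.

Lemma bform0l u : bform B 0 u = 0.
Proof. by rewrite /bform !mul0mx mxE. Qed.

Lemma bform0r u : bform B u 0 = 0.
Proof. by rewrite /bform trmx0 mulmx0 mxE. Qed.

Definition bformE := (bformDl, bformDr, bformNl, bformNr, bformZl, bformZr, bform0l, bform0r).

Lemma bform_mx k (A : 'M[F3]_(k, n)) u i :
  (A *m B *m u^T) i 0 = bform B (row i A) u.
Proof.
rewrite /bform -row_mul !mxE; apply: eq_bigr => j _.
by rewrite !mxE.
Qed.

Lemma bform_gram k l (A : 'M[F3]_(k, n)) (C : 'M[F3]_(l, n)) i j :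
  (A *m B *m C^T) i j = bform B (row i A) (row j C).
Proof.
rewrite -bform_mx !mxE; apply: eq_bigr => h _.
by rewrite !mxE.
Qed.

Lemma bformN_form u v : bform (- B) u v = - bform B u v.
Proof. by rewrite /bform mulmxN mulNmx mxE. Qed.

Hypothesis symB : B^T = B.

Lemma bformC u v : bform B u v = bform B v u.
Proof.
by rewrite /bform -{1}(trmxK (u *m B *m v^T)) mxE !trmx_mul trmxK symB mulmxA.
Qed.

End BilinearForm.

(** * Orthogonal complements and the norms they represent *)

Definition perp n (B : 'M[F3]_n) (s : seq 'rV[F3]_n) (v : 'rV[F3]_n) :=
  all (fun u => bform B u v == 0) s.

Lemma perp_cat n (B : 'M[F3]_n) s t v : perp B (s ++ t) v = perp B s v && perp B t v.
Proof. exact: all_cat. Qed.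

Definition rowseq n (s : seq 'rV[F3]_n) : 'M[F3]_(size s, n) := \matrix_i s`_i.

Lemma perpE n (B : 'M[F3]_n) s v : perp B s v = (rowseq s *m B *m v^T == 0).
Proof.
apply/idP/eqP => [/(all_nthP 0) sv|sv]; last first.
  apply/(all_nthP 0) => i lti; have := congr1 (fun M : 'cV_(size s) => M (Ordinal lti) 0) sv.
  by rewrite bform_mx mxE rowK => ->.
apply/matrixP => i j; rewrite ord1 bform_mx rowK mxE.
by apply/eqP; apply: sv.
Qed.

Definition orthogonal_seq n (B : 'M[F3]_n) (s : seq 'rV[F3]_n) :=
  pairwise (fun u v => bform B u v == 0) s && all (fun u => bform B u u != 0) s.

Lemma gram_orthogonal_seq n (B : 'M[F3]_n) s : B^T = B -> orthogonal_seq B s ->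
  rowseq s *m B *m (rowseq s)^T = diag_mx (\row_i bform B s`_i s`_i).
Proof.
move=> symB /andP[/(pairwiseP 0) pw _].
apply/matrixP => i j; rewrite bform_gram !rowK !mxE.
case: (ltngtP (i : nat) j) => [ltij|ltji|/val_inj ->]; last by rewrite eqxx.
- rewrite (negPf (_ : i != j)) ?mulr0n; last by rewrite -val_eqE neq_ltn ltij.
  by apply/eqP; apply: pw; rewrite ?inE.
- rewrite (negPf (_ : i != j)) ?mulr0n; last by rewrite -val_eqE neq_ltn ltji orbT.
  by rewrite bformC //; apply/eqP; apply: pw; rewrite ?inE.
Qed.

Lemma gram_unit n (B : 'M[F3]_n) s : B^T = B -> orthogonal_seq B s ->
  rowseq s *m B *m (rowseq s)^T \in unitmx.
Proof.
move=> symB os; rewrite gram_orthogonal_seq // unitmxE det_diag unitfE.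
case/andP: os => _ /(all_nthP 0) nz.
by apply/prodf_neq0 => i _; rewrite mxE; apply: nz.
Qed.

(** If 1 is not a value, an isotropic [u] lies in the radical: for [(u,v)] nonzero the norms of [v],
    [v + u], [v - u] exhaust GF(3). Rank at least 2 then leaves orthogonal [u], [v] of norm -1, and
    [u + v] has norm 1. *)
Lemma form_represents1 n (S : 'M[F3]_n) : S^T = S -> (2 <= \rank S)%N ->
  exists v, bform S v v = 1.
Proof.
move=> symS rkS; apply: contrapT => no1.
have no1' v : bform S v v != 1 by apply/eqP => h; apply: no1; exists v.
have nz_rad u : (forall v, bform S u v = 0) -> u *m S = 0.
  move=> h; apply/rowP => j; have := h (delta_mx 0 j).
  by rewrite /bform trmx_delta -colE !mxE.
have iso u : bform S u u = 0 -> u *m S = 0.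
  move=> uu; apply: nz_rad => v.
  have := no1' (v + u); have := no1' (v - u); have := no1' v.
  by move: uu; rewrite !bformE (bformC symS v u); f3.
have [u uS] : exists u : 'rV[F3]_n, u *m S != 0.
  apply: contrapT => h; move: rkS; suff -> : S = 0 by rewrite mxrank0.
  apply/row_matrixP => i; rewrite rowE row0; apply/eqP; apply: contrapT => k.
  by apply: h; exists (delta_mx 0 i); apply/negP.
(* Otherwise the complement of [u], of dimension at least n - 1, would lie in the radical, of
   dimension at most n - 2. *)
have [v uv vS] : exists2 v, bform S u v = 0 & v *m S != 0.
  apply: contrapT => h.
  have : (kermx (S *m u^T) <= kermx S)%MS.
    apply/rV_subP => v /sub_kermxP vu; apply/sub_kermxP; apply: contrapT => vS.
    apply: h; exists v; last by apply/eqP.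
    by rewrite bformC // /bform -mulmxA vu mxE.
  move/mxrankS; rewrite !mxrank_ker leqNgt; apply/negP; rewrite negbK.
  have rk1 : (\rank (S *m u^T) <= 1)%N by rewrite (leq_trans (rank_leq_col _)).
  have := rank_leq_row S; move: (\rank S) rkS (\rank _) rk1 => a a2 b b1 an.
  by apply: ltn_sub2l => //; [exact: leq_ltn_trans b1 (leq_trans a2 an)|exact: leq_ltn_trans b1 a2].
have nu : bform S u u != 0 by apply/eqP => /iso /eqP; apply/negP.
have nv : bform S v v != 0 by apply/eqP => /iso /eqP; apply/negP.
have := no1' (u + v); have := no1' u; have := no1' v.
by move: nu nv uv; rewrite !bformE (bformC symS v u); f3.
Qed.

(** By double orthogonality the form has the same radical on the row space of [A] and on its
    complement, namely their intersection; counting dimensions on both sides eliminates it. *)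
Lemma rank_perp_form n (B : 'M[F3]_n) k (A : 'M[F3]_(k, n)) :
  B^T = B -> B \in unitmx ->
  (\rank (kermx (B *m A^T) *m B *m (kermx (B *m A^T))^T) + \rank A + \rank A
   = n + \rank (A *m B *m A^T))%N.
Proof.
move=> symB uB; set K := kermx _.
have rk l (C : 'M[F3]_(l, n)) : (\rank (kermx (B *m C^T)) + \rank C = n)%N.
  rewrite mxrank_ker -mxrank_tr trmx_mul trmxK symB mxrankMfree ?row_free_unit //.
  by rewrite subnK // rank_leq_col.
have AK : (A == kermx (B *m K^T))%MS.
  rewrite -(geq_leqif (mxrank_leqif_eq _)).
    by rewrite -(leq_add2r (\rank K)) rk addnC rk.
  apply/sub_kermxP; have /(congr1 trmx) := mulmx_ker (B *m A^T).
  by rewrite trmx_mul (trmx_mul B) trmxK symB trmx0 -mulmxA.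
have := mxrank_mul_ker K (B *m K^T); rewrite -(cap_eqmx (eqmx_refl K) (eqmxP AK)) mulmxA.
have := mxrank_mul_ker A (B *m A^T); rewrite -/K capmxC mulmxA.
have := rk _ A; rewrite -/K.
move: (\rank (K *m B *m K^T)) (\rank (A *m B *m A^T)) (\rank (K :&: A)) (\rank K) (\rank A).
by lia.
Qed.

(** Passing to the complement costs rank 1 for each vector of the orthogonal list [s] and at most 2
    for each arbitrary vector of [t]. Rank at least 2 remains, enough to represent 1. *)
Lemma exists_plus n (B : 'M[F3]_n) (s t : seq 'rV[F3]_n) :
  B^T = B -> B \in unitmx -> orthogonal_seq B s ->
  (size s + 2 * size t + 2 <= n)%N ->
  exists v, [/\ bform B v v = 1, perp B s v & perp B t v].
Proof.
move=> symB uB os le.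
pose A := col_mx (rowseq s) (rowseq t); pose K := kermx (B *m A^T).
have rkE := rank_perp_form A symB uB; rewrite -/K /= in rkE.
have rkA : (\rank A <= size s + size t)%N by rewrite rank_leq_row.
have rkG : (size s <= \rank (A *m B *m A^T))%N.
  rewrite -[X in (X <= _)%N](mxrank_unit (gram_unit symB os)).
  (* The Gram matrix of [s] is a block of that of [A], cut out by a selection matrix. *)
  have -> : rowseq s *m B *m (rowseq s)^T =
     row_mx 1%:M 0 *m (A *m B *m A^T) *m (row_mx 1%:M 0)^T.
    rewrite !mulmxA mul_row_col mul1mx mul0mx addr0 -!mulmxA; congr (_ *m (_ *m _)).
    by rewrite -trmx_mul mul_row_col mul1mx mul0mx addr0.
  by apply: leq_trans (mxrankM_maxl _ _) (mxrankM_maxr _ _).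
have [||c Nc] := @form_represents1 _ (K *m B *m K^T).
- by rewrite trmx_mul trmxK trmx_mul symB mulmxA.
- by move: rkE rkA rkG le; move: (\rank (K *m B *m K^T)) (\rank (A *m B *m A^T)) (\rank A); lia.
have /sub_kermxP cKA : (c *m K <= K)%MS by exact: submxMl.
exists (c *m K); have : perp B (s ++ t) (c *m K).
  rewrite perp_cat !perpE; move/(congr1 trmx): cKA.
  rewrite trmx_mul (trmx_mul B) trmxK symB trmx0.
  by rewrite /A !mul_col_mx => /eqP; rewrite col_mx_eq0.
rewrite perp_cat => /andP[-> ->]; split => //.
by rewrite -Nc /bform trmx_mul !mulmxA.
Qed.

Lemma exists_minus n (B : 'M[F3]_n) (s t : seq 'rV[F3]_n) :
  B^T = B -> B \in unitmx -> orthogonal_seq B s ->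
  (size s + 2 * size t + 2 <= n)%N ->
  exists v, [/\ bform B v v = -1, perp B s v & perp B t v].
Proof.
have pN r v : perp (- B) r v = perp B r v.
  by apply: eq_all => u /=; rewrite bformN_form oppr_eq0.
move=> symB uB os le; have [|||v] := @exists_plus _ (- B) s t _ _ _ le.
- by rewrite linearN /= symB.
- by rewrite -scaleN1r unitmxZ.
- case/andP: os => os1 os2; apply/andP; split.
    by apply: sub_pairwise os1 => u v; rewrite bformN_form oppr_eq0.
  by rewrite (eq_all (a2 := fun u => bform B u u != 0)) // => u; rewrite bformN_form oppr_eq0.
rewrite !pN bformN_form => -[Nv ps pt]; exists v; split => //.
by rewrite -Nv opprK.
Qed.

(** Span membership unrolled one vector at a time, so that the coefficients become scalars open to
    case analysis. *)
Fixpoint lincomb n (s : seq 'rV[F3]_n) (c : 'rV[F3]_n) : Prop :=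
  if s is v :: s' then exists a : F3, lincomb s' (c - a *: v) else c = 0.

Lemma separate n (B : 'M[F3]_n) (s : seq 'rV[F3]_n) c : B \in unitmx ->
  (exists2 u, perp B s u & bform B c u = 1) \/ lincomb s c.
Proof.
move=> uB; case: (boolP (c <= rowseq s)%MS) => [cs|].
  right; elim: s c cs => [|v s IHs] c /submxP[D Dc].
    by rewrite Dc /=; apply/rowP => j; rewrite mxE big_ord0 mxE.
  exists (D 0 ord0); apply: IHs; apply/submxP; exists (\row_i D 0 (lift ord0 i)).
  rewrite Dc !mulmx_sum_row big_ord_recl /= rowK /= addrC addKr.
  by apply: eq_bigr => i _; rewrite !rowK mxE.
rewrite -(submxMfree _ _ (_ : row_free B)) ?row_free_unit // => ncs; left.
have [w w1 w2] : exists2 w : 'cV[F3]_n, rowseq s *m B *m w = 0 & (c *m B *m w) 0 0 != 0.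
  have /rV0Pn[j cj] : c *m B *m cokermx (rowseq s *m B) != 0 by rewrite -submxE.
  exists (col j (cokermx (rowseq s *m B))); first by rewrite colE mulmxA mulmx_coker mul0mx.
  by rewrite colE mulmxA -colE mxE.
(* A nonzero scalar of GF(3) is its own inverse, so scaling by the value itself normalises it to
   1. *)
pose u := ((c *m B *m w) 0 0) *: w^T.
exists u; first by rewrite perpE /u linearZ /= trmxK -scalemxAr w1 scaler0.
rewrite /bform /u linearZ /= trmxK -scalemxAr mxE.
by move: ((c *m B *m w) 0 0) w2; f3.
Qed.

Definition rich_form n (B : 'M[F3]_n) := (7 <= n)%N \/ n = 6 /\ \det B = 1.

Lemma rich_form_ge6 n (B : 'M[F3]_n) : rich_form B -> (6 <= n)%N.
Proof. by case=> [/ltnW|[n6 _]] //; rewrite n6. Qed.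

Section PerpendicularVectors.
Variables (n : nat) (B : 'M[F3]_n).
Hypotheses (symB : B^T = B) (uB : B \in unitmx).
Implicit Types (a b c d q r t u v w z : 'rV[F3]_n) (s : seq 'rV[F3]_n).

Notation "<< u , v >>" := (bform B u v) (format "<< u ,  v >>").

Lemma lincomb_perp s c v : lincomb s c -> perp B s v -> <<c, v>> = 0.
Proof.
elim: s c => [|u s IHs] c /=; first by move=> ->; rewrite bform0l.
by case=> x /IHs sc /andP[/eqP uv /sc {sc}]; rewrite !bformE uv; move: x; f3.
Qed.

Lemma lincomb_perp0 s c : orthogonal_seq B s -> lincomb s c -> perp B s c -> c = 0.
Proof.
rewrite /orthogonal_seq; elim: s c => [|v s IHs] c //=.
case/andP=> /andP[vs pw] /andP[Nv nz] [x sc] /andP[/eqP vc sc0].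
have sv : perp B s v by apply: sub_all vs => u; rewrite bformC.
have x0 : x = 0.
  by move: (lincomb_perp sc sv) Nv vc; rewrite !bformE (bformC symB v c); clear sc; move: x; f3.
by move: sc; rewrite x0 scale0r subr0 => sc; apply: IHs => //; rewrite pw nz.
Qed.

Lemma perp_comb s u v x : perp B s u -> perp B s v -> perp B s (u + x *: v).
Proof.
move=> /allP su /allP sv; apply/allP => w ws.
by rewrite !bformE (eqP (su w ws)) (eqP (sv w ws)) mulr0 addr0.
Qed.

(** Adding x times [q] to [u] lowers the norm by x, because 2 = -1; [plus_fix] uses the same
    shift. *)
Lemma isotropic_fix q u : <<q, q>> = 0 -> <<q, u>> = 1 ->
  <<u + <<u, u>> *: q, u + <<u, u>> *: q>> = 0.
Proof. by rewrite !bformE (bformC symB u q); f3. Qed.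

Lemma plus_fix q u : <<q, q>> = 0 -> <<q, u>> = 1 ->
  <<u + (<<u, u>> - 1) *: q, u + (<<u, u>> - 1) *: q>> = 1.
Proof. by rewrite !bformE (bformC symB u q); f3. Qed.

Lemma exists_nonisotropic s : orthogonal_seq B s -> (size s < n)%N ->
  exists2 v, <<v, v>> != 0 & perp B s v.
Proof.
move=> os lts; pose A := rowseq s; pose K := kermx (B *m A^T).
have rkE := rank_perp_form A symB uB; rewrite -/K in rkE.
have rkA : (\rank A <= size s)%N by rewrite rank_leq_row.
have rkG := mxrank_unit (gram_unit symB os); rewrite -/A in rkG.
have S0 : K *m B *m K^T != 0.
  rewrite -mxrank_eq0; move: rkE rkA rkG lts.
  by move: (\rank (K *m B *m K^T)) (\rank (A *m B *m A^T)) (\rank A); lia.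
apply: contrapT => no; case/negP: S0; apply/eqP/matrixP => i j; rewrite bform_gram mxE.
have iso v : (v <= K)%MS -> <<v, v>> = 0.
  move=> /sub_kermxP vK; apply/eqP; apply: contrapT => Nv; apply: no.
  exists v; first exact/negP.
  rewrite perpE; move/(congr1 trmx): vK.
  by rewrite trmx_mul (trmx_mul B) trmxK symB trmx0 => ->.
have iso2 u v : (u <= K)%MS -> (v <= K)%MS -> <<u, v>> = 0.
  move=> uK vK; have := iso _ (addmx_sub uK vK); move: (iso u uK) (iso v vK).
  by rewrite !bformE (bformC symB v u); f3.
by apply: iso2; exact: row_sub.
Qed.

(** The norms of an orthogonal basis multiply to the discriminant, since nonzero squares are 1; each
    nonzero scalar being its own inverse, the last norm is determined. *)
Lemma exists_last_perp s : orthogonal_seq B s -> (size s).+1 = n ->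
  exists2 v, perp B s v & <<v, v>> = \det B * \prod_(u <- s) <<u, u>>.
Proof.
move=> os sz; have [v Nv sv] : exists2 v, <<v, v>> != 0 & perp B s v.
  by apply: exists_nonisotropic; rewrite ?sz.
exists v => //; pose t := rcons s v; pose P := \matrix_(i < n) t`_i.
have szt : size t = n by rewrite size_rcons.
have gram : P *m B *m P^T = diag_mx (\row_i <<t`_i, t`_i>>).
  have ot : orthogonal_seq B t.
    case/andP: os => pw nz; rewrite /orthogonal_seq /t -cats1 pairwise_cat all_cat pw nz /= Nv !andbT.
    by rewrite allrel1r.
  have /matrixP := gram_orthogonal_seq symB ot => h.
  apply/matrixP => i j; have := h (cast_ord (esym szt) i) (cast_ord (esym szt) j).
  by rewrite !bform_gram !rowK !mxE /=.
have := congr1 determinant gram; rewrite !det_mulmx det_tr det_diag.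
under eq_bigr do rewrite mxE.
rewrite -(big_mkord xpredT (fun i => <<t`_i, t`_i>>)) -[X in index_iota 0 X]szt.
rewrite -(big_nth 0 xpredT (fun u => <<u, u>>)) /t -cats1 big_cat big_seq1 /=.
have : \prod_(u <- s) <<u, u>> != 0.
  by rewrite prodf_seq_neq0; case/andP: os.
move: Nv; move: (\prod_(_ <- _) _) (\det P) (\det B).
by f3.
Qed.

(* For n = 6 the three given vectors may leave only a line free modulo the radical: here the discriminant decides. *)
Lemma exists_plus_perp_isotropic r a b : rich_form B -> <<r, r>> = 0 ->
  <<a, a>> = 1 -> <<b, b>> = 1 -> <<r, a>> = 0 -> <<r, b>> = 0 ->
  exists c, [/\ <<c, c>> = 1, <<r, c>> = 0, <<a, c>> = 0 & <<b, c>> = 0].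
Proof.
move=> rich Nr Na Nb ra rb; have n6 := rich_form_ge6 rich.
have os1 : orthogonal_seq B [:: a] by rewrite /orthogonal_seq /= Na.
have [ab|nab] := eqVneq <<a, b>> 0.
  have [||c []] := @exists_plus _ _ [:: a; b] [:: r] symB uB => //.
    by rewrite /orthogonal_seq /= ab Na Nb eqxx.
  by move=> Nc /and3P[/eqP ? /eqP ? _] /andP[/eqP ? _]; exists c.
(* As [a] and [b] have norm 1 and product 1 or -1, [t] lies in the radical of their span, and [a],
   [t] generate it. *)
have [t tE] : exists t, t = a - <<a, b>> *: b by exists (a - <<a, b>> *: b).
have [Nt at0 rt] : [/\ <<t, t>> = 0, <<a, t>> = 0 & <<r, t>> = 0].
  by split; move: Na Nb ra rb nab; rewrite tE !bformE ?(bformC symB b a); f3.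
have tb c : <<a, c>> = 0 -> <<t, c>> = 0 -> <<b, c>> = 0.
  by move: nab; rewrite tE !bformE; f3.
case: (rich) => [n7|[n6E det1]].
  have [||c [Nc]] := @exists_plus _ _ [:: a] [:: r; t] symB uB => //=.
  by move=> /andP[/eqP ac _] /and3P[/eqP rc /eqP /(tb _ ac) bc _]; exists c.
(* If [r] and [t] are dependent, one isotropic condition suffices and the count needs only dimension
   5. *)
have easy : lincomb [:: t] r \/ lincomb [:: r] t ->
  exists c, [/\ <<c, c>> = 1, <<r, c>> = 0, <<a, c>> = 0 & <<b, c>> = 0].
  case=> -[y /= /subr0_eq yE].
    have [||c [Nc]] := @exists_plus _ _ [:: a] [:: t] symB uB => //=; first by lia.
    move=> /andP[/eqP ac _] /andP[/eqP tc _]; exists c; split => //; last exact: tb.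
    by rewrite yE bformE tc mulr0.
  have [||c [Nc]] := @exists_plus _ _ [:: a] [:: r] symB uB => //=; first by lia.
  move=> /andP[/eqP ac _] /andP[/eqP rc _]; exists c; split => //; apply: tb => //.
  by rewrite yE bformE rc mulr0.
have [|[y [y' /= /subr0_eq rE]]] := separate [:: a; t] r uB; last first.
  apply: easy; left; exists y' => /=.
  suff y0 : y = 0 by move: rE; rewrite y0 scale0r subr0 => ->; rewrite subrr.
  by have := congr1 (bform B a) rE; rewrite !bformE Na at0 (bformC symB a r) ra; clear; move: y y'; f3.
case=> r1 /and3P[/eqP ar1 /eqP tr1 _] rr1.
(* [r'] and later [t'] complete [r] and [t] to orthogonal hyperbolic pairs, both orthogonal to
   [a]. *)
have [r' r'E] : exists r', r' = r1 + <<r1, r1>> *: r by exists (r1 + <<r1, r1>> *: r).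
have Nr' : <<r', r'>> = 0 by rewrite r'E; apply: isotropic_fix.
have ar' : <<a, r'>> = 0 by rewrite r'E !bformE ar1 (bformC symB a r) ra; f3.
have tr' : <<t, r'>> = 0 by rewrite r'E !bformE tr1 (bformC symB t r) rt; f3.
have rr' : <<r, r'>> = 1 by rewrite r'E !bformE rr1 Nr; f3.
have [|[y [y1 [y2 /= tE2]]]] := separate [:: a; r; r'] t uB; last first.
  apply: easy; right; exists y1.
  have h := congr1 (bform B ^~ _) tE2; have := h a; have := h r; have := h r'.
  rewrite !bformE Na Nr Nr' ra ar' (bformC symB a r) ra (bformC symB r' r) rr' tr'.
  rewrite (bformC symB t a) at0 (bformC symB t r) rt (bformC symB r' a) ar'.
  move=> e1 e2 e3; have y0 : y = 0 by move: e3; clear; move: y y1 y2; f3.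
  have y20 : y2 = 0 by move: e2; clear; move: y y1 y2; f3.
  by move: tE2; rewrite y0 y20 !scale0r !subr0.
case=> t1 /and4P[/eqP at1 /eqP rt1 /eqP r't1 _] tt1.
have [t' t'E] : exists t', t' = t1 + <<t1, t1>> *: t by exists (t1 + <<t1, t1>> *: t).
have Nt' : <<t', t'>> = 0 by rewrite t'E; apply: isotropic_fix.
have at' : <<a, t'>> = 0 by rewrite t'E !bformE at1 at0; f3.
have rt' : <<r, t'>> = 0 by rewrite t'E !bformE rt1 rt; f3.
have r't' : <<r', t'>> = 0 by rewrite t'E !bformE r't1 (bformC symB r' t) tr'; f3.
have tt' : <<t, t'>> = 1 by rewrite t'E !bformE tt1 Nt; f3.
(* Sum and difference of a hyperbolic pair have norms -1 and 1, so the five norms multiply to 1 and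
   the remaining direction has norm [\det B = 1]. *)
have [||c] := @exists_last_perp [:: a; r + r'; r - r'; t + t'; t - t'] => //=.
  rewrite /orthogonal_seq /= !bformE Na Nr Nr' Nt Nt' at0 ar' at' rt rt' r't' rr' tt'.
  rewrite (bformC symB a r) ra (bformC symB r' t) tr' (bformC symB r' r) rr'.
  by rewrite (bformC symB t' t) tt'; vm_compute.
rewrite /perp /= andbT => /and5P[/eqP ac p1 p2 p3 p4]; rewrite !big_cons big_nil det1 => Nc.
exists c; split => //; last apply: tb => //.
- rewrite Nc !bformE Na Nr Nr' Nt Nt' rr' tt' (bformC symB r' r) rr' (bformC symB t' t) tt'.
  by f3.
- by move: p1 p2; rewrite !bformE; f3.
- by move: p3 p4; rewrite !bformE; f3.
Qed.

End PerpendicularVectors.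

(** * Recovering vectors from the norm 1 vectors orthogonal to them *)

Section RecoveringVectors.
Variables (n : nat) (B : 'M[F3]_n).
Hypotheses (symB : B^T = B) (uB : B \in unitmx).
Implicit Types (a b c d q r t u v w z : 'rV[F3]_n) (s : seq 'rV[F3]_n).

Notation "<< u , v >>" := (bform B u v) (format "<< u ,  v >>").

(** If [a] and [b] differ, they span a degenerate plane with radical [a - b], whose norm 1 points
    are [a], [b], [a + b]. The last hypothesis forces [c] into the span: [c] minus its component
    along [a] is isotropic and must be a multiple of [a - b]. *)
Lemma third_point z a b c : (6 <= n)%N ->
  <<z, z>> = 1 -> <<a, a>> = 1 -> <<b, b>> = 1 -> <<c, c>> = 1 ->
  <<z, a>> = 0 -> <<z, b>> = 0 -> <<z, c>> = 0 -> <<a, b>> = 1 ->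
  (forall d, <<d, d>> = 1 -> perp B [:: z; a; b] d -> <<c, d>> = 0) ->
  exists2 x : F3, x != 0 & [\/ c = x *: a, c = x *: b | c = x *: (a + b)].
Proof.
move=> n6 Nz Na Nb Nc za zb zc ab cd.
have [t tE] : exists t, t = a - b by exists (a - b).
have tt : <<t, t>> = 0 by rewrite tE !bformE Na Nb (bformC symB b a) ab; f3.
have at0 : <<a, t>> = 0 by rewrite tE !bformE Na ab; f3.
have bt : <<b, t>> = 0 by rewrite tE !bformE Nb (bformC symB b a) ab; f3.
have zt : <<z, t>> = 0 by rewrite tE !bformE za zb; f3.
have bE u : <<a, u>> = 0 -> <<t, u>> = 0 -> <<b, u>> = 0 by rewrite tE !bformE; f3.
have ct : <<c, t>> = 0.
  (* The hypothesis on [c] applies to both [d] and [d + t]; the difference is [<<c, t>>]. *)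
  have [||d [Nd]] := @exists_plus _ _ [:: z; a] [:: t] symB uB => //.
    by rewrite /orthogonal_seq /= Nz Na za eqxx.
  rewrite /perp /= !andbT => /andP[/eqP zd /eqP ad] /eqP td.
  have := cd d Nd; have := cd (d + t).
  rewrite /perp /= !bformE zd ad (bE d) // zt at0 bt tt Nd (bformC symB d t) td.
  rewrite !addr0 eqxx => /(_ erefl isT) cdt /(_ isT) cd0.
  by rewrite -cdt cd0 add0r.
have ca : <<c, a>> != 0.
  apply/eqP => ca; have := cd c Nc; rewrite Nc /perp /= zc (bformC symB a c) ca.
  by rewrite bE ?eqxx ?(bformC symB _ c) // => /(_ isT)/eqP; rewrite oner_eq0.
have [x xE] : exists x, x = <<c, a>> by exists <<c, a>>.
have [c' c'E] : exists c', c' = c - x *: a by exists (c - x *: a).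
have c'a : <<a, c'>> = 0 by move: ca; rewrite c'E !bformE xE Na (bformC symB a c); f3.
have c'z : <<z, c'>> = 0 by rewrite c'E !bformE zc za; move: (x); f3.
have c't : <<t, c'>> = 0 by rewrite c'E !bformE !(bformC symB t) ct at0; move: (x); f3.
have Nc' : <<c', c'>> = 0.
  by move: ca; rewrite c'E !bformE Nc Na (bformC symB a c) xE; f3.
case: (separate [:: z; a; t] c' uB) => [[u]|[y1 [y2 [y3 /= c'E2]]]].
  rewrite /perp /= !andbT => /and3P[/eqP zu /eqP au /eqP tu] c'u.
  have [v vE] : exists v, v = u + (<<u, u>> - 1) *: c' by exists (u + (<<u, u>> - 1) *: c').
  have Nv : <<v, v>> = 1 by rewrite vE; apply: plus_fix.
  have av : <<a, v>> = 0 by rewrite vE !bformE au c'a mulr0 addr0.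
  have := cd v Nv; rewrite /perp /= av bE // ?vE !bformE ?zu ?tu ?c'z ?c't ?mulr0 ?addr0 // eqxx.
  move=> /(_ isT); move: c'u Nc'; rewrite c'E !bformE au (bformC symB a c) -xE.
  by move: ca; rewrite -xE; rewrite Nc Na; move: (x); f3.
have az : <<a, z>> = 0 by rewrite bformC.
have e1 := congr1 (bform B z) c'E2; have e2 := congr1 (bform B a) c'E2.
rewrite !bformE Nz za zt c'z in e1; rewrite !bformE Na az at0 c'a in e2.
have y10 : y1 = 0 by move: e1; clear; move: y1 y2 y3; f3.
have y20 : y2 = 0 by move: e2; clear; move: y1 y2 y3; f3.
have {c'E2} cE : c = x *: a + y3 *: (a - b).
  move: c'E2; rewrite y10 y20 !scale0r !subr0 c'E tE => /eqP.
  by rewrite subr_eq0 subr_eq addrC => /eqP.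
move: ca; rewrite -xE cE; clear; move: x y3; elim/F3_elim => //; elim/F3_elim => // _.
- by exists 1 => //; apply: Or31; rewrite scale0r addr0.
- exists (-1) => //; apply: Or33; rewrite !scale1r scaleN1r.
  by apply/rowP => i; rewrite !mxE; move: (a 0 i) (b 0 i); f3.
- by exists 1 => //; apply: Or32; rewrite !scale1r scaleN1r opprB addrC subrK.
- by exists (-1) => //; apply: Or31; rewrite scale0r addr0.
- by exists (-1) => //; apply: Or32; rewrite scale1r !scaleN1r addrA addNr add0r.
- exists 1 => //; apply: Or33; rewrite !scale1r !scaleN1r.
  by apply/rowP => i; rewrite !mxE; move: (a 0 i) (b 0 i); f3.
Qed.

(** Comparing [d] with [d + q] makes [q] and [q'] orthogonal. A [u] orthogonal to [q] and [s] but
    with product 1 with [q'] could be shifted along [q'] to norm 1, against the hypothesis; so [q']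
    lies in the span. *)
Lemma isotropic_unique s q q' : orthogonal_seq B s -> (size s + 4 <= n)%N ->
  <<q, q>> = 0 -> <<q', q'>> = 0 -> q' != 0 -> perp B s q -> perp B s q' ->
  (forall d, <<d, d>> = 1 -> perp B s d -> <<q, d>> = 0 -> <<q', d>> = 0) ->
  exists2 x : F3, x != 0 & q' = x *: q.
Proof.
move=> os szs Nq Nq' q'0 sq sq' H.
have qq' : <<q, q'>> = 0.
  have [||d [Nd sd]] := @exists_plus _ _ s [:: q] symB uB => //=; first by lia.
  move=> /andP[/eqP qd _]; have := H d Nd sd qd; have := H (d + 1 *: q) _ (perp_comb 1 sd sq).
  by rewrite !bformE (bformC symB d q) qd Nd Nq (bformC symB q' q) !mulr0 !addr0 => /(_ erefl erefl); f3.
case: (separate (q :: s) q' uB) => [[u /= /andP[/eqP qu su] q'u]|[x]].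
  have := H _ (plus_fix symB Nq' q'u) (perp_comb (<<u, u>> - 1) su sq').
  by rewrite !bformE qu qq' q'u Nq' !mulr0 addr0 => /(_ erefl)/eqP.
move=> sx; have := lincomb_perp0 symB os sx.
have -> : q' - x *: q = q' + (- x) *: q by rewrite scaleNr.
move=> /(_ (perp_comb (- x) sq' sq))/eqP; rewrite scaleNr subr_eq0 => /eqP q'E.
by exists x => //; apply: contraNneq q'0 => x0; rewrite q'E x0 scale0r.
Qed.

(** A [c] of norm 1 can itself be taken as [d]; one of norm -1 is completed to norm 1 by an
    orthogonal vector of norm -1; an isotropic one serves to shift a vector to norm 1. *)
Lemma plus_span s c : orthogonal_seq B s -> (size s + 3 <= n)%N -> perp B s c ->
  (forall d, <<d, d>> = 1 -> perp B s d -> <<c, d>> = 0) -> c = 0.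
Proof.
move=> os szs sc H.
have Nc1 : <<c, c>> <> 1 by move=> Nc; have := H c Nc sc; rewrite Nc => /eqP.
have Ncm : <<c, c>> <> -1.
  move=> Nc; have [||d [Nd]] := @exists_minus _ _ (c :: s) [::] symB uB; last 1 first.
  - move=> /= /andP[/eqP cd sd] _.
    have Ncd : <<c + 1 *: d, c + 1 *: d>> = 1 by rewrite !bformE (bformC symB d c) cd Nc Nd; f3.
    by have := H _ Ncd (perp_comb 1 sc sd); rewrite !bformE cd Nc; f3.
  - case/andP: os => pw nz; rewrite /orthogonal_seq /= pw nz Nc !andbT.
    by apply: sub_all sc => u; rewrite (bformC symB u).
  - by move=> /=; lia.
have Nc : <<c, c>> = 0 by move: Nc1 Ncm; elim/F3_elim: <<c, c>>.
case: (separate s c uB) => [[u su cu]|/(lincomb_perp0 symB os)]; last exact.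
have := H _ (plus_fix symB Nc cu) (perp_comb _ su sc).
by rewrite !bformE cu Nc mulr0 addr0 => /eqP.
Qed.

End RecoveringVectors.

(** * Hyperbolic planes and nonorthogonal isotropic vectors *)

Section HyperbolicPlanes.
Variables (n : nat) (B : 'M[F3]_n).
Hypotheses (symB : B^T = B) (uB : B \in unitmx).
Implicit Types (a b c d q r t u v w z : 'rV[F3]_n) (s : seq 'rV[F3]_n).

Notation "<< u , v >>" := (bform B u v) (format "<< u ,  v >>").

(** For [r1], [r2] orthogonal, shifting [d] by each of them shows [c] orthogonal to both, so [c]
    itself qualifies as [d], which is absurd. Otherwise [c] lies in the hyperbolic plane, which has
    one norm 1 vector up to sign. *)
Lemma plane_root a r1 r2 c : rich_form B ->
  <<a, a>> = 1 -> <<a, r1>> = 0 -> <<a, r2>> = 0 -> <<a, c>> = 0 -> <<c, c>> = 1 ->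
  <<r1, r1>> = 0 -> <<r2, r2>> = 0 ->
  (forall d, <<d, d>> = 1 -> perp B [:: a; r1; r2] d -> <<c, d>> = 0) ->
  <<r1, r2>> != 0 /\ exists2 x : F3, x != 0 & c = x *: (r1 - <<r1, r2>> *: r2).
Proof.
move=> rich Na ar1 ar2 ac Nc N1 N2 H; have n6 := rich_form_ge6 rich.
have n12 : <<r1, r2>> != 0.
  apply/eqP => r12.
  (* Since [a + r2] has norm 1, orthogonality to [a] and [r2] becomes a condition on two norm 1
     vectors. *)
  have [|||d [Nd r1d ad]] := @exists_plus_perp_isotropic _ _ symB uB r1 a (a + r2) rich N1 Na.
  - by rewrite !bformE Na N2 (bformC symB r2 a) ar2; f3.
  - by rewrite bformC.
  - by rewrite !bformE r12 bformC // ar1; f3.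
  rewrite bformDl ad add0r => r2d.
  have r21 : <<r2, r1>> = 0 by rewrite bformC.
  have cd : <<c, d>> = 0 by apply: H => //; rewrite /perp /= ad r1d r2d eqxx.
  have cq q : <<q, q>> = 0 -> <<q, d>> = 0 -> perp B [:: a; r1; r2] q -> <<c, q>> = 0.
    move=> Nq qd pq; have : <<c, d + 1 *: q>> = 0.
      apply: H; first by rewrite !bformE (bformC symB d) Nd Nq qd; f3.
      by apply: perp_comb => //; rewrite /perp /= ad r1d r2d eqxx.
    by rewrite !bformE cd add0r mul1r.
  have := H c Nc; rewrite Nc /perp /= ac !(bformC symB _ c) !cq ?eqxx //.
  - by move=> /(_ isT)/eqP.
  - by rewrite /perp /= ar2 r12 N2 eqxx.
  - by rewrite /perp /= ar1 N1 r21 eqxx.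
split=> //; have [x xE] : exists x, x = <<r1, r2>> by exists <<r1, r2>>.
rewrite -xE in n12 *.
(* As [x] is its own inverse, the subtracted part is the projection of [c] onto the hyperbolic
   plane. *)
have [c' c'E] : exists c', c' = c - (x * <<c, r2>>) *: r1 - (x * <<c, r1>>) *: r2.
  by exists (c - (x * <<c, r2>>) *: r1 - (x * <<c, r1>>) *: r2).
have c'0 : c' = 0.
  apply: (@plus_span _ _ symB uB [:: a; r1 + r2; r1 - r2]) => //=.
  - rewrite /orthogonal_seq /= !bformE (bformC symB r2 r1) -xE N1 N2 Na ar1 ar2.
    by move: n12; clear; move: x; f3.
  - rewrite c'E !bformE (bformC symB r2 r1) -xE N1 N2 ar1 ar2 ac.
    rewrite !(bformC symB _ c); move: n12; clear; move: x; f3.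
  move=> d Nd; rewrite /perp /= !bformE andbT => /and3P[/eqP ad p1 p2].
  have r1d : <<r1, d>> = 0 by move: p1 p2; f3.
  have r2d : <<r2, d>> = 0 by move: p1 p2; f3.
  by rewrite c'E !bformE r1d r2d H /perp /= ?ad ?r1d ?r2d ?eqxx // !mulr0 !subr0.
have {c'E c'0} cE : c = (x * <<c, r2>>) *: r1 + (x * <<c, r1>>) *: r2.
  by apply/eqP; rewrite -subr_eq0 opprD addrA -c'E c'0.
move: cE; move: (x * <<c, r2>>) (x * <<c, r1>>) => y1 y2 cE.
have e : y2 = - x * y1.
  move: Nc; rewrite cE !bformE N1 N2 (bformC symB r2 r1) -xE.
  by clear; move: x y1 y2; f3.
exists y1; first by move: e Nc; rewrite {2}cE bformDr !bformZr; clear; move: x y1 y2; f3.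
by rewrite cE e mulNr scaleNr scalerBr scalerA (mulrC y1).
Qed.

Lemma exists_isotropic_fix q u : <<q, q>> = 0 -> <<q, u>> = 1 ->
  exists x : F3, <<u + x *: q, u + x *: q>> = 0.
Proof. by move=> Nq qu; exists <<u, u>>; apply: isotropic_fix. Qed.

(** Vectors dual to [r] and [r'] are added, one sufficing when these are proportional; a shift along
    [r] makes the sum isotropic without changing its products with [r] and [r']. *)
Lemma exists_isotropic_meeting2 r r' : <<r, r>> = 0 -> <<r', r'>> = 0 -> r != 0 -> r' != 0 ->
  <<r, r'>> = 0 -> exists2 a, <<a, a>> = 0 & <<r, a>> != 0 /\ <<r', a>> != 0.
Proof.
move=> Nr Nr' r0 r'0 rr'; have r'r : <<r', r>> = 0 by rewrite bformC.
have nz q : q != 0 -> exists u, <<q, u>> = 1.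
  move=> q0; case: (separate [::] q uB) => [[u _ qu]|/= qE]; first by exists u.
  by rewrite qE eqxx in q0.
case: (separate [:: r] r' uB) => [[u]|[x /= /subr0_eq r'E]]; last first.
  have [u ru] := nz r r0; have [y Ny] := exists_isotropic_fix Nr ru.
  have rx : <<r, u + y *: r>> = 1 by rewrite !bformE ru Nr mulr0 addr0.
  exists (u + y *: r) => //; rewrite r'E bformZl rx mulr1 oner_eq0; split=> //.
  by apply: contraNneq r'0 => x0; rewrite r'E x0 scale0r.
rewrite /perp /= andbT => /eqP ru r'u.
case: (separate [:: r'] r uB) => [[v]|[x /= /subr0_eq rE]]; last first.
  by move: r'u; have := ru; rewrite rE bformZl => + r'u; rewrite r'u mulr1 => x0; rewrite rE x0 scale0r eqxx in r0.
rewrite /perp /= andbT => /eqP r'v rv.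
have ruv : <<r, u + v>> = 1 by rewrite bformDr ru rv add0r.
have [y Ny] := exists_isotropic_fix Nr ruv.
by exists (u + v + y *: r) => //; rewrite !bformE ru rv Nr r'u r'v r'r; clear; move: y; f3.
Qed.

(** The sum [r1 + r2] meets both [r1] and [r2]; a vector dual to [r0] and orthogonal to both is
    added, and a shift along [r0] makes the result isotropic. *)
Lemma exists_isotropic_meeting3 r1 r2 r0 : <<r1, r1>> = 0 -> <<r2, r2>> = 0 -> <<r0, r0>> = 0 ->
  r0 != 0 -> <<r1, r2>> != 0 -> <<r0, r1>> = 0 -> <<r0, r2>> = 0 ->
  exists2 a, <<a, a>> = 0 & [/\ <<r0, a>> != 0, <<r1, a>> != 0 & <<r2, a>> != 0].
Proof.
move=> N1 N2 N0 r0n n12 r01 r02; have n21 : <<r2, r1>> != 0 by rewrite bformC.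
have r10 : <<r1, r0>> = 0 by rewrite bformC.
have r20 : <<r2, r0>> = 0 by rewrite bformC.
case: (separate [:: r1; r2] r0 uB) => [[u]|[x [y /= r0E]]].
  rewrite /perp /= andbT => /andP[/eqP r1u /eqP r2u] r0u.
  have h : <<r0, u + r1 + r2>> = 1 by rewrite !bformE r0u r01 r02 !addr0.
  have [y Ny] := exists_isotropic_fix N0 h.
  exists (u + r1 + r2 + y *: r0) => //; rewrite !bformE r0u r1u r2u r01 r02 r10 r20 N0 N1 N2.
  by move: n12 n21; clear; move: y; f3.
have e1 := congr1 (bform B r1) r0E; have e2 := congr1 (bform B r2) r0E.
rewrite !bformE r10 N1 in e1; rewrite !bformE r20 N2 in e2.
have x0 : x = 0 by move: e2 n21; clear; move: x y; f3.
have y0 : y = 0 by move: e1 n12; clear; move: x y; f3.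
by move: r0E; rewrite x0 y0 !scale0r !subr0 => r0E; rewrite r0E eqxx in r0n.
Qed.

End HyperbolicPlanes.

Section IsotropicLinks.
Variables (n : nat) (B : 'M[F3]_n).
Hypotheses (symB : B^T = B) (uB : B \in unitmx).
Implicit Types (a b c d q r t u v w z : 'rV[F3]_n) (s : seq 'rV[F3]_n).

Notation "<< u , v >>" := (bform B u v) (format "<< u ,  v >>").

(* In the affine space of isotropic a with <<a, r0>> = 1, parametrised by <a, r0>^perp, the form between two points is
   the norm of their difference; c is a point at nonisotropic distance from both a and b. *)
Lemma exists_isotropic_link r0 r a b : (6 <= n)%N ->
  <<r0, r0>> = 0 -> <<r, r>> = 0 -> <<a, a>> = 0 -> <<b, b>> = 0 ->
  <<r0, r>> = 0 -> <<a, b>> = 0 ->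
  <<r0, a>> != 0 -> <<r, a>> != 0 -> <<r0, b>> != 0 ->
  exists2 c, <<c, c>> = 0 & [/\ <<r0, c>> != 0, <<r, c>> != 0, <<a, c>> != 0 & <<b, c>> != 0].
Proof.
move=> n6 N0 Nr; wlog : a b / <<r0, a>> = 1 /\ <<r0, b>> = 1.
  move=> wl Na Nb r0r ab n0a nra n0b.
  have sc x u v : <<x *: u, v>> != 0 -> <<u, v>> != 0.
    by apply: contraNneq => uv; rewrite bformE uv mulr0.
  have [||||||||c Nc [h1 h2 h3 h4]] := wl (<<r0, a>> *: a) (<<r0, b>> *: b).
  - by rewrite !bformE; split; move: n0a n0b; f3.
  - by rewrite !bformE Na !mulr0.
  - by rewrite !bformE Nb !mulr0.
  - by [].
  - by rewrite !bformE ab !mulr0.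
  - by rewrite bformE mulf_neq0.
  - by rewrite bformE mulf_neq0.
  - by rewrite bformE mulf_neq0.
  by exists c => //; split => //; [apply: sc h3|apply: sc h4].
case=> r0a r0b Na Nb r0r ab _ nra _.
have ar0 : <<a, r0>> = 1 by rewrite bformC.
have rr0 : <<r, r0>> = 0 by rewrite bformC.
have [w1 w1E] : exists w1, w1 = b - a by exists (b - a).
have [q qE] : exists q, q = r - <<r, a>> *: r0 by exists (r - <<r, a>> *: r0).
have Nq : <<q, q>> = 0 by rewrite qE !bformE Nr N0 r0r rr0; f3.
have N1 : <<w1, w1>> = 0 by rewrite w1E !bformE Na Nb (bformC symB b a) ab; f3.
have aw1 : <<a, w1>> = 0 by rewrite w1E !bformE Na ab; f3.
have r0w1 : <<r0, w1>> = 0 by rewrite w1E !bformE r0a r0b; f3.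
have r0q : <<r0, q>> = 0 by rewrite qE !bformE r0r N0; f3.
have aq : <<a, q>> = 0 by rewrite qE !bformE ar0 (bformC symB a r); f3.
(* Then [a + w + r0] is isotropic, with product 1 with [a] and [r0], [<<r, a>>] with [r], and
   [1 + <<w1, w>>] with [b]. *)
suff [w [Nw aw r0w qw w1w]] : exists w,
    [/\ <<w, w>> = 1, <<a, w>> = 0, <<r0, w>> = 0, <<q, w>> = 0 & <<w1, w>> <> -1].
  exists (a + w + r0).
    by rewrite !bformE !(bformC symB w) Na Nw N0 aw ar0 r0a r0w; f3.
  have -> : r = q + <<r, a>> *: r0 by rewrite qE subrK.
  have -> : b = w1 + a by rewrite w1E subrK.
  move: nra w1w; rewrite !bformE r0a r0w N0 (bformC symB q a) aq qw (bformC symB q r0) r0q.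
  by rewrite Na aw ar0 (bformC symB w1 a) aw1 (bformC symB w1 r0) r0w1; f3.
have os2 : orthogonal_seq B [:: a + r0; a - r0].
  by rewrite /orthogonal_seq /= !bformE Na N0 ar0 r0a; f3.
have hyp w : perp B [:: a + r0; a - r0] w -> <<a, w>> = 0 /\ <<r0, w>> = 0.
  by rewrite /perp /= andbT !bformE => /andP[]; f3.
(* If [q] and [w1] span a hyperbolic plane, [w] is taken orthogonal to it. Otherwise [<<w1, w>>] can
   be made 1, or [w1] is a multiple of [q]. *)
have [qw1|nqw1] := eqVneq <<q, w1>> 0; last first.
  have [||w [Nw]] := @exists_plus _ _ [:: a + r0; a - r0; q + w1; q - w1] [::] symB uB => //.
    rewrite /orthogonal_seq /= !bformE Na N0 ar0 r0a Nq N1 aq aw1 r0q r0w1 (bformC symB w1 q).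
    by move: nqw1; f3.
  rewrite -[[:: _; _; _; _]]/([:: a + r0; a - r0] ++ [:: q + w1; q - w1]) perp_cat.
  move=> /andP[/hyp[aw r0w]]; rewrite /perp /= !bformE andbT => /andP[p1 p2] _.
  exists w; split => //; first by move: p1 p2; f3.
  by move: p1 p2; f3.
case: (separate [:: a; r0; q] w1 uB) => [[u]|[x [y [z /= w1E2]]]].
  rewrite /perp /= andbT => /and3P[/eqP au /eqP r0u /eqP qu] w1u.
  exists (u + (<<u, u>> - 1) *: w1); split; first exact: plus_fix.
  - by rewrite !bformE au aw1 mulr0 addr0.
  - by rewrite !bformE r0u r0w1 mulr0 addr0.
  - by rewrite !bformE qu qw1 mulr0 addr0.
  - by rewrite !bformE w1u N1 mulr0 addr0; f3.
have e1 := congr1 (bform B r0) w1E2; have e2 := congr1 (bform B a) w1E2.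
rewrite !bformE r0w1 r0a N0 r0q in e1; rewrite !bformE aw1 Na ar0 aq in e2.
have x0 : x = 0 by move: e1; clear; move: x y z; f3.
have y0 : y = 0 by move: e2; clear; move: x y z; f3.
have [||w [Nw]] := @exists_plus _ _ [:: a + r0; a - r0] [:: q] symB uB => //.
move=> /hyp[aw r0w]; rewrite /perp /= andbT => /eqP qw; exists w; split => //.
by move: w1E2; rewrite x0 y0 !scale0r !subr0 => /subr0_eq->; rewrite bformZl qw mulr0; f3.
Qed.

End IsotropicLinks.

(** * Graphs represented by norm 1 points *)

(* p represents the graph induced on X by the norm 1 points of the subspace orthogonal to s. *)
Record represents (V : Type) (e : V -> V -> Prop) (X : V -> Prop) n (B : 'M[F3]_n)
    (s : seq 'rV[F3]_n) (p : V -> 'rV[F3]_n) : Prop := Repr {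
  repr_norm : forall v, X v -> bform B (p v) (p v) = 1;
  repr_perp : forall v, X v -> perp B s (p v);
  repr_onto : forall c, bform B c c = 1 -> perp B s c ->
    exists2 v, X v & exists2 x : F3, x != 0 & p v = x *: c;
  repr_inj : forall v w (x : F3), X v -> X w -> p v = x *: p w -> v = w;
  repr_adj : forall v w, X v -> X w -> e v w <-> bform B (p v) (p w) = 0 }.

Lemma iff_eqb (P : Prop) (x y : F3) : (P <-> x = 0) -> (P <-> y = 0) -> (x == 0) = (y == 0).
Proof. by move=> [px xp] [py yp]; apply/eqP/eqP => [/xp/py|/yp/px]. Qed.

Lemma repr_nbr (V : Type) (e : V -> V -> Prop) n (B : 'M[F3]_n) p X z :
  B^T = B -> represents e X B [::] p -> X z -> represents e (fun v => X v /\ e z v) B [:: p z] p.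
Proof.
move=> symB rp Xz; split.
- by move=> v [Xv _]; apply: (repr_norm rp).
- by move=> v [Xv zv]; rewrite /perp /= andbT; apply/eqP/(repr_adj rp).
- move=> c Nc; rewrite /perp /= andbT => /eqP zc.
  have [v Xv [x x0 pv]] := repr_onto rp Nc isT; exists v; last by exists x.
  by split=> //; apply/(repr_adj rp) => //; rewrite pv bformZr zc mulr0.
- by move=> v w x [Xv _] [Xw _]; apply: (repr_inj rp).
- by move=> v w [Xv _] [Xw _]; apply: (repr_adj rp).
Qed.

Section TwoRepresentations.
Variables (V : Type) (e : V -> V -> Prop) (X : V -> Prop) (n : nat).
Variables (B B' : 'M[F3]_n) (a a' : 'rV[F3]_n) (p p' : V -> 'rV[F3]_n).
Hypotheses (symB : B^T = B) (symB' : B'^T = B') (uB : B \in unitmx) (uB' : B' \in unitmx).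
Hypotheses (rich : rich_form B) (rich' : rich_form B').
Hypotheses (Na : bform B a a = 1) (Na' : bform B' a' a' = 1).
Hypotheses (rp : represents e X B [:: a] p) (rp' : represents e X B' [:: a'] p').

(* The points orthogonal to s are those adjacent to all or to none of the points c, c + s, c - s. *)
Lemma transport_isotropic s : bform B s s = 0 -> s != 0 -> bform B a s = 0 ->
  exists s', [/\ bform B' s' s' = 0, s' != 0, bform B' a' s' = 0 &
    forall d, X d -> (bform B s (p d) = 0 <-> bform B' s' (p' d) = 0)].
Proof.
move=> Ns s0 as0; have n6 := rich_form_ge6 rich.
have [||c [Nc]] := @exists_plus _ _ [:: a] [:: s] symB uB => //=.
- by rewrite /orthogonal_seq /= Na.
- by lia.
rewrite /perp /= !andbT => /eqP ac /eqP sc.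
have cs : bform B c s = 0 by rewrite bformC.
have pt y : exists2 C, X C & exists2 x : F3, x != 0 & p C = x *: (c + y *: s).
  apply: (repr_onto rp); first by rewrite !bformE Nc cs sc Ns; move: y; f3.
  by rewrite /perp /= andbT !bformE ac as0 mulr0 addr0.
have [C1 X1 [x1 x10 p1]] := pt 0; have [C2 X2 [x2 x20 p2]] := pt 1.
have [C3 X3 [x3 x30 p3]] := pt (-1).
have adj C D x y : X C -> X D -> x != 0 -> p C = x *: (c + y *: s) ->
  (e C D <-> bform B c (p D) + y * bform B s (p D) = 0).
  move=> XC XD x0 pC; apply: (iff_trans (repr_adj rp XC XD)); rewrite pC !bformE.
  by split=> [/eqP|->]; rewrite ?mulr0 // mulf_eq0 (negPf x0) => /eqP.
have diff C D x x' y y' : x != 0 -> p C = x *: (c + y *: s) ->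
    p D = x' *: (c + y' *: s) -> y != y' -> C <> D.
  move=> x0 pC pD yy' CD; have := congr1 (bform B c) pD; rewrite -CD pC !bformE Nc cs !mulr0 !addr0 !mulr1 => xx'.
  have /eqP : x *: ((y - y') *: s) = 0.
    apply/eqP; rewrite scalerBl scalerBr subr_eq0; apply/eqP.
    by move: pD; rewrite -CD pC -xx' !scalerDr => /addrI.
  by rewrite !scaler_eq0 (negPf x0) (negPf s0) subr_eq0 (negPf yy').
have d12 := diff _ _ _ _ _ _ x10 p1 p2 isT; have d13 := diff _ _ _ _ _ _ x10 p1 p3 isT.
have d23 := diff _ _ _ _ _ _ x20 p2 p3 isT.
have [A1 A1E] : exists A1, A1 = p' C1 by exists (p' C1).
have [y yE] : exists y, y = bform B' A1 (p' C2) by exists (bform B' A1 (p' C2)).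
have y0 : y != 0.
  apply/eqP; rewrite yE A1E => /(repr_adj rp' X1 X2)/(adj _ _ _ _ X1 X2 x10 p1).
  by rewrite p2 !bformE Nc cs sc Ns; move/eqP: x20; clear; move: x2; f3.
have [A2 A2E] : exists A2, A2 = y *: p' C2 by exists (y *: p' C2).
have NA1 : bform B' A1 A1 = 1 by rewrite A1E; apply: (repr_norm rp').
have NA2 : bform B' A2 A2 = 1.
  by rewrite A2E !bformE (repr_norm rp') //; move: y0; clear; move: y; f3.
have A12 : bform B' A1 A2 = 1.
  by rewrite A2E bformE -yE; move: y0; clear; move: y; f3.
have aA C : X C -> bform B' a' (p' C) = 0 by move=> /(repr_perp rp') /andP[/eqP].
have aA1 : bform B' a' A1 = 0 by rewrite A1E aA.
have aA2 : bform B' a' A2 = 0 by rewrite A2E bformE aA ?mulr0.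
have adjA2 D : X D -> (e C2 D <-> bform B' A2 (p' D) = 0).
  move=> XD; apply: (iff_trans (repr_adj rp' X2 XD)); rewrite A2E bformE.
  by split=> [->|/eqP]; rewrite ?mulr0 // mulf_eq0 (negPf y0) => /eqP.
have adjA1 D : X D -> (e C1 D <-> bform B' A1 (p' D) = 0).
  by move=> XD; rewrite A1E; apply: (repr_adj rp').
(* A common neighbour of [C1] and [C2] in [X] is orthogonal to [c] and [s], hence adjacent to [C3];
   so [p' C3] lies in the span of [A1] and [A2]. *)
have [|x x0] := @third_point _ _ symB' uB' a' A1 A2 (p' C3) n6 Na' NA1 NA2 (repr_norm rp' X3) aA1 aA2 (aA _ X3) A12.
  move=> d Nd; rewrite /perp /= andbT => /and3P[/eqP a'd /eqP A1d /eqP A2d].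
  have [|D XD [z z0 p'D]] := repr_onto rp' Nd; first by rewrite /perp /= a'd eqxx.
  have /(adj _ _ _ _ X1 XD x10 p1) e1 : e C1 D by apply/(adjA1 _ XD); rewrite p'D bformE A1d mulr0.
  have /(adj _ _ _ _ X2 XD x20 p2) e2 : e C2 D by apply/(adjA2 _ XD); rewrite p'D bformE A2d mulr0.
  have /(repr_adj rp' X3 XD) : e C3 D by apply/(adj _ _ _ _ X3 XD x30 p3); move: e1 e2; f3.
  by rewrite p'D bformE; move/eqP; rewrite mulf_eq0 (negPf z0) => /eqP.
case; rewrite ?A2E ?A1E ?scalerA.
- by move=> /(repr_inj rp' X3 X1)/esym.
- by move=> /(repr_inj rp' X3 X2)/esym.
rewrite -A1E -A2E => A3E.
exists (A1 - A2); split.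
- by rewrite !bformE NA1 NA2 A12 (bformC symB') A12; f3.
- by apply/eqP => /subr0_eq; rewrite A1E A2E => /(repr_inj rp' X1 X2).
- by rewrite !bformE aA1 aA2 subr0.
move=> d Xd; have := iff_eqb (adj _ _ _ _ X1 Xd x10 p1) (adjA1 _ Xd).
have := iff_eqb (adj _ _ _ _ X2 Xd x20 p2) (adjA2 _ Xd).
have := iff_eqb (adj _ _ _ _ X3 Xd x30 p3) (repr_adj rp' X3 Xd).
by rewrite A3E !bformE; move: x0; clear; move: x; f3.
Qed.

(* The root of the hyperbolic plane <r1, r2> is the only point adjacent to every point orthogonal to r1 and r2. *)
Lemma transport_triple r1 r2 r3 q1 q2 q3 :
  bform B r1 r1 = 0 -> bform B r2 r2 = 0 -> bform B' q1 q1 = 0 -> bform B' q2 q2 = 0 ->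
  bform B a r1 = 0 -> bform B a r2 = 0 -> bform B' a' q1 = 0 -> bform B' a' q2 = 0 ->
  (forall d, X d -> (bform B r1 (p d) = 0 <-> bform B' q1 (p' d) = 0)) ->
  (forall d, X d -> (bform B r2 (p d) = 0 <-> bform B' q2 (p' d) = 0)) ->
  (forall d, X d -> (bform B r3 (p d) = 0 <-> bform B' q3 (p' d) = 0)) ->
  bform B r1 r2 != 0 ->
  bform B' q1 q2 != 0 /\
  (bform B r1 r3 = bform B r1 r2 * bform B r2 r3 <->
   bform B' q1 q3 = bform B' q1 q2 * bform B' q2 q3).
Proof.
move=> N1 N2 M1 M2 ar1 ar2 aq1 aq2 R1 R2 R3 r12.
have [c cE] : exists c, c = r1 - bform B r1 r2 *: r2 by exists (r1 - bform B r1 r2 *: r2).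
have [||Z XZ [x x0 pZ]] := @repr_onto _ _ _ _ _ _ _ rp c.
- by rewrite cE !bformE N1 N2 (bformC symB r2 r1); move: r12; f3.
- by rewrite /perp /= andbT cE !bformE ar1 ar2 mulr0 subr0.
have aZ : bform B' a' (p' Z) = 0 by have /andP[/eqP] := repr_perp rp' XZ.
have [|q12 [y y0 ZE]] := @plane_root _ _ symB' uB' a' q1 q2 (p' Z) rich' Na' aq1 aq2 aZ (repr_norm rp' XZ) M1 M2.
  move=> d Nd; rewrite /perp /= andbT => /and3P[/eqP a'd /eqP q1d /eqP q2d].
  have [|D XD [z z0 p'D]] := repr_onto rp' Nd; first by rewrite /perp /= a'd eqxx.
  have d1 : bform B r1 (p D) = 0 by apply/(R1 _ XD); rewrite p'D bformE q1d mulr0.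
  have d2 : bform B r2 (p D) = 0 by apply/(R2 _ XD); rewrite p'D bformE q2d mulr0.
  have /(repr_adj rp' XZ XD) : e Z D.
    by apply/(repr_adj rp XZ XD); rewrite pZ cE !bformE d1 d2 mulr0 subr0 mulr0.
  by rewrite p'D bformE; move/eqP; rewrite mulf_eq0 (negPf z0) => /eqP.
(* The relation to be transported says that [r3] is orthogonal to the root, and [R3] carries this
   over at [Z]. *)
split=> //; have [h1 h2] := R3 _ XZ; rewrite pZ cE ZE !bformE in h1 h2.
rewrite !(bformC symB r3) in h1 h2; rewrite !(bformC symB' q3) in h1 h2.
have eqz (u t : F3) : u != 0 -> u * t = 0 -> t = 0.
  by move=> u0 /eqP; rewrite mulf_eq0 (negPf u0) => /eqP.
split=> h.
- by apply/eqP; rewrite -subr_eq0; apply/eqP/(eqz _ _ y0)/h1; rewrite h subrr mulr0.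
- by apply/eqP; rewrite -subr_eq0; apply/eqP/(eqz _ _ x0)/h2; rewrite h subrr mulr0.
Qed.

End TwoRepresentations.

(** * Passing between graph isomorphisms and representations *)

Lemma span1P n (u v : 'rV[F3]_n) : reflect (exists x : F3, u = x *: v) (u \in span1 v).
Proof. by apply: (iffP imsetP) => [[x _ ->]|[x ->]]; exists x. Qed.

Lemma span1_refl n (v : 'rV[F3]_n) : v \in span1 v.
Proof. by apply/span1P; exists 1; rewrite scale1r. Qed.

Lemma span1Z n (v : 'rV[F3]_n) (x : F3) : x != 0 -> span1 (x *: v) = span1 v.
Proof.
move=> x0; apply/setP => u; apply/span1P/span1P => [[y ->]|[y ->]].
  by exists (y * x); rewrite scalerA.
by exists (y / x); rewrite scalerA divfK.
Qed.

Lemma SigmaAdjP n (B : 'M[F3]_n) (S T : SigmaV B) u v :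
  val S = span1 u -> val T = span1 v -> SigmaAdj S T <-> bform B u v = 0.
Proof.
move=> Su Tv; split=> [|uv u' v']; first by apply; rewrite ?Su ?Tv span1_refl.
by rewrite Su Tv => /span1P[x ->] /span1P[y ->]; rewrite !bformE uv !mulr0.
Qed.

Lemma plus_point_span1 n (B : 'M[F3]_n) v : bform B v v = 1 -> plus_point B (span1 v).
Proof. by move=> Nv; apply/existsP; exists v; rewrite Nv !eqxx. Qed.

Lemma iso_repr (V : Type) (e : V -> V -> Prop) n (B : 'M[F3]_n) :
  graph_iso e (@SigmaAdj n B) -> exists q, represents e (fun _ => True) B [::] q.
Proof.
move=> [f [[g fK gK] fe]].
have /choice[q qP] v : exists u, val (f v) = span1 u /\ bform B u u = 1.
  have /existsP[u /andP[/eqP fu /eqP Nu]] := valP (f v).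
  by exists u.
have qE v := proj1 (qP v); have Nq v := proj2 (qP v).
have nz v (x : F3) c : q v = x *: c -> x != 0.
  by move=> qv; apply/eqP => x0; have := Nq v; rewrite qv x0 scale0r bform0l => /eqP.
exists q; split => //.
- move=> c Nc _; pose S : SigmaV B := Sub (span1 c) (plus_point_span1 Nc).
  exists (g S) => //; have : q (g S) \in span1 c.
    by rewrite -[span1 c](SubK (SigmaV B) (plus_point_span1 Nc)) -/S -(gK S) fK qE span1_refl.
  by case/span1P => x qx; exists x => //; apply: nz qx.
- move=> v w x _ _ vw; rewrite -(fK v) -(fK w); congr g; apply: val_inj.
  by rewrite !qE vw span1Z //; apply: nz vw.
- by move=> v w _ _; apply: (iff_trans (fe v w)); apply: SigmaAdjP.
Qed.

Lemma iso_repr_nbhd (V : Type) (e : V -> V -> Prop) v n (B : 'M[F3]_n) :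
  graph_iso (@nbhd_adj V e v) (@SigmaAdj n B) -> exists p, represents e (e v) B [::] p.
Proof.
case/iso_repr => q rq.
(* Outside the neighbourhood of [v] the value 0 is an arbitrary default. *)
pose p w := if pselect (e v w) is left h then q (exist _ w h) else 0.
have pE w (h : e v w) : p w = q (exist _ w h).
  by rewrite /p; case: pselect => // h'; rewrite (Prop_irrelevance h h').
exists p; split => //.
- by move=> w h; rewrite pE (repr_norm rq).
- move=> c Nc _; have [[w h] _ [x x0 qx]] := repr_onto rq Nc isT.
  by exists w => //; exists x => //; rewrite pE.
- move=> w w' x h h'; rewrite !pE => /(repr_inj rq I I).
  by move/(congr1 (@proj1_sig _ _)).
- by move=> w w' h h'; rewrite !pE; apply: (@repr_adj _ _ _ _ _ _ _ rq (exist _ w h) (exist _ w' h')).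
Qed.

Lemma repr_iso (V : Type) (e : V -> V -> Prop) n (B : 'M[F3]_n) p :
  represents e (fun _ => True) B [::] p -> graph_iso e (@SigmaAdj n B).
Proof.
move=> rp; have Np v : bform B (p v) (p v) = 1 by apply: (repr_norm rp).
pose f v : SigmaV B := Sub (span1 (p v)) (plus_point_span1 (Np v)).
have fE v : val (f v) = span1 (p v) by apply: SubK.
have /choice[g gK] S : exists v, f v = S.
  have /existsP[u /andP[/eqP Su /eqP Nu]] := valP S.
  have [v _ [x x0 pv]] := repr_onto rp Nu isT; exists v; apply: val_inj.
  by rewrite fE pv span1Z // Su.
exists f; split; last by move=> v w; apply: (iff_trans (repr_adj rp I I)); apply: iff_sym; apply: SigmaAdjP.
exists g => // v; have := congr1 val (gK (f v)); rewrite !fE => gv.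
have /span1P[x] : p (g (f v)) \in span1 (p v) by rewrite -gv span1_refl.
by apply: (repr_inj rp).
Qed.

(** * Graphs locally isomorphic to Sigma *)

Lemma F3_neq0 (x : F3) : x != 0 -> x = 1 \/ x = -1.
Proof. by elim/F3_elim: x => // _; [left|right]. Qed.

Lemma addrr_F3 n (u : 'rV[F3]_n) : u + u = - u.
Proof. by apply/rowP => i; rewrite !mxE; move: (u 0 i); f3. Qed.

(** The part [q] of [r3] orthogonal to the hyperbolic plane of [r1] and [r2] is not isotropic, so
    the three vectors span a nondegenerate space and cost only 1 each in [exists_plus]. *)
Lemma exists_plus_perp3 n (B : 'M[F3]_n) r1 r2 r3 : B^T = B -> B \in unitmx -> (5 <= n)%N ->
  bform B r1 r1 = 0 -> bform B r2 r2 = 0 -> bform B r3 r3 = 0 ->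
  bform B r1 r2 != 0 -> bform B r2 r3 != 0 -> bform B r1 r3 != 0 ->
  exists v, [/\ bform B v v = 1, bform B r1 v = 0, bform B r2 v = 0 & bform B r3 v = 0].
Proof.
move=> symB uB n5 N1 N2 N3 n12 n23 n13.
have [x xE] : exists x, x = bform B r1 r2 * bform B r2 r3 by exists (bform B r1 r2 * bform B r2 r3).
have [y yE] : exists y, y = bform B r1 r2 * bform B r1 r3 by exists (bform B r1 r2 * bform B r1 r3).
have [q qE] : exists q, q = r3 - x *: r1 - y *: r2 by exists (r3 - x *: r1 - y *: r2).
have q1 : bform B r1 q = 0 by rewrite qE !bformE N1 mulr0 yE; move: n12; f3.
have q2 : bform B r2 q = 0 by rewrite qE !bformE N2 mulr0 xE (bformC symB r2 r1); move: n12; f3.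
have Nq : bform B q q != 0.
  have -> : bform B q q = bform B r3 q by rewrite {1}qE !bformE q1 q2 !mulr0 !subr0.
  rewrite qE !bformE N3 (bformC symB r3 r1) (bformC symB r3 r2) xE yE.
  by move: n12 n13 n23; f3.
have [||v [Nv]] := @exists_plus _ _ [:: r1 + r2; r1 - r2; q] [::] symB uB => //.
  rewrite /orthogonal_seq /= Nq !bformE N1 N2 q1 q2 (bformC symB r2 r1).
  by move: n12; f3.
rewrite /perp /= !bformE !andbT => /and3P[p1 p2 /eqP qv] _.
have r1v : bform B r1 v = 0 by move: p1 p2; f3.
have r2v : bform B r2 v = 0 by move: p1 p2; f3.
exists v; split=> //; move: qv; rewrite qE !bformE r1v r2v.
by rewrite !mulr0 !subr0.
Qed.

Section LocallySigma.
Variables (V : Type) (e : V -> V -> Prop) (n : nat).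
Variables (B : V -> 'M[F3]_n) (p : V -> V -> 'rV[F3]_n).
Hypotheses (symE : forall x y, e x y -> e y x) (irrE : forall x, ~ e x x).
Hypotheses (symB : forall x, (B x)^T = B x) (uB : forall x, B x \in unitmx).
Hypotheses (rich : forall x, rich_form (B x)).
Hypothesis rp : forall x, represents e (e x) (B x) [::] (p x).

Notation "<< u , v >>_ x" := (bform (B x) u v) (at level 0, x at level 0, format "<< u ,  v >>_ x").

Let Np x z : e x z -> <<p x z, p x z>>_x = 1.
Proof. exact: (repr_norm (rp x)). Qed.

Let adj x v w : e x v -> e x w -> e v w <-> <<p x v, p x w>>_x = 0.
Proof. exact: (repr_adj (rp x)). Qed.

Let n6 (x : V) : (6 <= n)%N.
Proof. exact: rich_form_ge6 (rich x). Qed.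

(** With [repr_common'] this represents the common neighbours of [x] and [z] in both spaces, which
    is what the transport lemmas compare. *)
Lemma repr_common x z : e x z -> represents e (fun v => e x v /\ e z v) (B x) [:: p x z] (p x).
Proof. by move=> xz; apply: (repr_nbr _ (rp x)). Qed.

Lemma repr_common' x z : e x z -> represents e (fun v => e x v /\ e z v) (B z) [:: p z x] (p z).
Proof.
move=> xz; have [h1 h2 h3 h4 h5] := repr_common (symE xz); split.
- by move=> v [? ?]; apply: h1.
- by move=> v [? ?]; apply: h2.
- by move=> c Nc pc; have [v [? ?] ?] := h3 c Nc pc; exists v.
- by move=> v w t [? ?] [? ?]; apply: h4.
- by move=> v w [? ?] [? ?]; apply: h5.
Qed.

Definition nonadj x y := y <> x /\ ~ e x y.

(* With y scaled so that its product with x in the space of z is 1, this is the isotropic vector y - x. *)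
Definition offset x z y : 'rV[F3]_n := <<p z x, p z y>>_z *: p z y - p z x.

(** * Vertices at distance 2 seen from a common neighbour *)

Section Offset.
Variables x z : V.
Hypothesis xz : e x z.
Let zx : e z x. Proof. exact: symE. Qed.

Lemma offset_nz y : nonadj x y -> e z y -> <<p z x, p z y>>_z != 0.
Proof. by case=> _ xy zy; apply/eqP => /(adj zx zy). Qed.

Lemma offset_perp y : nonadj x y -> e z y -> <<p z x, offset x z y>>_z = 0.
Proof.
move=> xy zy; have := offset_nz xy zy; rewrite /offset !bformE (Np zx); by f3.
Qed.

Lemma offset_isotropic y : nonadj x y -> e z y -> <<offset x z y, offset x z y>>_z = 0.
Proof.
move=> xy zy; have := offset_nz xy zy; rewrite /offset !bformE (Np zx) (Np zy) (bformC (symB z) (p z y)).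
by f3.
Qed.

Lemma offset_neq0 y : nonadj x y -> e z y -> offset x z y != 0.
Proof.
move=> [yx xy] zy; apply/eqP => /subr0_eq/esym/(repr_inj (rp z) zx zy) xE.
by apply: yx.
Qed.

Lemma offset_common y d : nonadj x y -> e z y -> e x d -> e z d ->
  e y d <-> <<offset x z y, p z d>>_z = 0.
Proof.
move=> xy zy xd zd; apply: (iff_trans (adj zy zd)).
have /(adj zx zd) := xd; have := offset_nz xy zy; rewrite /offset !bformE.
by f3.
Qed.

(** Suitably scaled, [y] is [x] plus its offset, so the product of two such vectors is 1 plus that
    of their offsets. *)
Lemma offset_adj y y' : nonadj x y -> nonadj x y' -> e z y -> e z y' ->
  e y y' <-> <<offset x z y, offset x z y'>>_z = -1.
Proof.
move=> xy xy' zy zy'; apply: (iff_trans (adj zy zy')).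
have := offset_nz xy zy; have := offset_nz xy' zy'; rewrite /offset !bformE (Np zx) (bformC (symB z) (p z y) (p z x)).
by f3.
Qed.

Lemma offset_inj y y' : e z y -> e z y' -> nonadj x y ->
  offset x z y = offset x z y' -> y = y'.
Proof.
move=> zy zy' /offset_nz/(_ zy) nz /addIr h; move: (h) => /(congr1 (fun u => (<<p z x, p z y>>_z)^-1 *: u)).
by rewrite !scalerA mulVf // scale1r => /(repr_inj (rp z) zy zy').
Qed.

Lemma offset_onto s : s != 0 -> <<s, s>>_z = 0 -> <<p z x, s>>_z = 0 ->
  exists y, [/\ nonadj x y, e z y & offset x z y = s].
Proof.
move=> s0 Ns xs; have [||y zy [c c0 py]] := @repr_onto _ _ _ _ _ _ _ (rp z) (p z x + s) => //.
  by rewrite !bformE (Np zx) (bformC (symB z) s) xs Ns; f3.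
have nz : <<p z x, p z y>>_z = c by rewrite py !bformE (Np zx) xs addr0 mulr1.
have oy : offset x z y = s.
  rewrite /offset nz py scalerA.
  suff -> : c * c = 1 by rewrite scale1r addrC addKr.
  by move: c0; clear; move: c; f3.
exists y; split => //; split.
  by move=> yx; move: oy s0; rewrite /offset yx (Np zx) scale1r subrr => <-; rewrite eqxx.
by move=> /(adj zx zy); rewrite nz; apply/eqP.
Qed.

End Offset.

(** * The isotropic vector of a pair of vertices at distance 2 *)

Definition mu_vec x y r := [/\ <<r, r>>_x = 0, r != 0 &
  forall c, e x c -> (e y c <-> <<r, p x c>>_x = 0)].

Lemma mu_vec_local x y z : nonadj x y -> e x z -> e y z ->
  exists r, [/\ <<r, r>>_x = 0, r != 0, <<p x z, r>>_x = 0 &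
    forall d, e x d -> e z d -> (e y d <-> <<r, p x d>>_x = 0)].
Proof.
move=> xy xz /symE zy; have zx := symE xz.
have [r [Nr r0 zr rP]] := transport_isotropic (symB z) (symB x) (uB z) (uB x) (rich z)
  (Np zx) (Np xz) (repr_common' xz) (repr_common xz) (offset_isotropic xz xy zy)
  (offset_neq0 xz xy zy) (offset_perp xz xy zy).
exists r; split => // d xd zd; apply: (iff_trans (offset_common xz xy zy xd zd)).
exact: rP.
Qed.

Lemma mu_vec_exists x y z : nonadj x y -> e x z -> e y z -> exists r, mu_vec x y r.
Proof.
move=> xy xz yz.
have eqv z1 z2 r1 r2 : e x z1 -> e x z2 -> e z1 z2 -> e y z1 -> e y z2 ->
    [/\ <<r1, r1>>_x = 0, r1 != 0, <<p x z1, r1>>_x = 0 &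
      forall d, e x d -> e z1 d -> (e y d <-> <<r1, p x d>>_x = 0)] ->
    [/\ <<r2, r2>>_x = 0, r2 != 0, <<p x z2, r2>>_x = 0 &
      forall d, e x d -> e z2 d -> (e y d <-> <<r2, p x d>>_x = 0)] ->
    exists2 k : F3, k != 0 & r2 = k *: r1.
  move=> xz1 xz2 z12 yz1 yz2 [N1 r10 zr1 P1] [N2 r20 zr2 P2].
  have o12 : <<p x z1, p x z2>>_x = 0 by apply/(adj xz1 xz2).
  have zr12 : <<p x z2, r1>>_x = 0 by rewrite bformC //; apply/(P1 _ xz2 z12).
  have zr21 : <<p x z1, r2>>_x = 0 by rewrite bformC //; apply/(P2 _ xz1 (symE z12)).
  apply: (@isotropic_unique _ _ (symB x) (uB x) [:: p x z1; p x z2]) => //.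
  - by rewrite /orthogonal_seq /= o12 (Np xz1) (Np xz2) eqxx.
  - exact: n6 x.
  - by rewrite /perp /= zr1 zr12 eqxx.
  - by rewrite /perp /= zr2 zr21 eqxx.
  move=> d Nd; rewrite /perp /= andbT => /andP[/eqP z1d /eqP z2d] r1d.
  have [v xv [k k0 pv]] := repr_onto (rp x) Nd isT.
  have z1v : e z1 v by apply/(adj xz1 xv); rewrite pv bformZr z1d mulr0.
  have z2v : e z2 v by apply/(adj xz2 xv); rewrite pv bformZr z2d mulr0.
  have /(P2 _ xv z2v) : e y v by apply/(P1 _ xv z1v); rewrite pv bformZr r1d mulr0.
  by rewrite pv bformZr => /eqP; rewrite mulf_eq0 (negPf k0) => /eqP.
(* Any [c] orthogonal to [r1] shares with [z1] a neighbour [v] that is also orthogonal to [r1]; the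
   local vector propagates along [z1], [v], [c]. *)
have step z1 r1 c : e x z1 -> e y z1 ->
    [/\ <<r1, r1>>_x = 0, r1 != 0, <<p x z1, r1>>_x = 0 &
      forall d, e x d -> e z1 d -> (e y d <-> <<r1, p x d>>_x = 0)] ->
    e x c -> <<r1, p x c>>_x = 0 ->
    e y c /\ forall rc, [/\ <<rc, rc>>_x = 0, rc != 0, <<p x c, rc>>_x = 0 &
      forall d, e x d -> e c d -> (e y d <-> <<rc, p x d>>_x = 0)] ->
      exists2 k : F3, k != 0 & rc = k *: r1.
  move=> xz1 yz1 H1 xc r1c; case: (H1) => N1 r10 zr1 P1.
  have [|d [Nd r1d z1d cd]] := exists_plus_perp_isotropic (symB x) (uB x) (rich x) N1 (Np xz1) (Np xc) _ r1c.
    by rewrite bformC.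
  have [v xv [k k0 pv]] := repr_onto (rp x) Nd isT.
  have z1v : e z1 v by apply/(adj xz1 xv); rewrite pv bformZr z1d mulr0.
  have cv : e c v by apply/(adj xc xv); rewrite pv bformZr cd mulr0.
  have yv : e y v by apply/(P1 _ xv z1v); rewrite pv bformZr r1d mulr0.
  have [rv Hv] := mu_vec_local xy xv yv.
  have [k1 k10 rvE] := eqv _ _ _ _ xz1 xv z1v yz1 yv H1 Hv.
  have yc : e y c.
    by case: Hv => _ _ _ Pv; apply/(Pv _ xc (symE cv)); rewrite rvE bformZl r1c mulr0.
  split=> // rc Hc; have [k2 k20 rcE] := eqv _ _ _ _ xv xc (symE cv) yv yc Hv Hc.
  by exists (k2 * k1); rewrite ?mulf_neq0 // rcE rvE scalerA.
have [r Hr] := mu_vec_local xy xz yz; exists r; case: (Hr) => Nr r0 zr Pr; split=> // c xc.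
split; last by move=> rc; case: (step _ _ _ xz yz Hr xc rc).
move=> yc; have [rc Hc] := mu_vec_local xy xc yc; case: (Hc) => Nc rc0 crc Pc.
(* Conversely, a point orthogonal to both [r] and [rc] links these local vectors and shows them
   proportional. *)
have [||d [Nd _]] := @exists_plus _ _ [::] [:: r; rc] (symB x) (uB x) => //.
  exact: n6 x.
rewrite /perp /= andbT => /andP[/eqP rd /eqP rcd].
have [v xv [k k0 pv]] := repr_onto (rp x) Nd isT.
have [|yv uv] := step _ _ v xz yz Hr xv; first by rewrite pv bformZr rd mulr0.
have [|_ uv'] := step _ _ v xc yc Hc xv; first by rewrite pv bformZr rcd mulr0.
have [rv Hv] := mu_vec_local xy xv yv.
have [k1 k10 e1] := uv _ Hv; have [k2 k20 e2] := uv' _ Hv.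
have : k1 * <<r, p x c>>_x = 0.
  by rewrite -bformZl -e1 e2 bformZl bformC // crc mulr0.
by move/eqP; rewrite mulf_eq0 (negPf k10) => /eqP.
Qed.

Lemma mu_vec_unique x y r r' : mu_vec x y r -> mu_vec x y r' ->
  exists2 k : F3, k != 0 & r' = k *: r.
Proof.
move=> [N r0 P] [N' r'0 P'].
apply: (@isotropic_unique _ _ (symB x) (uB x) [::]) => //; first exact: leq_trans (n6 x).
move=> d Nd _ rd; have [v xv [k k0 pv]] := repr_onto (rp x) Nd isT.
have /(P' _ xv) : e y v by apply/(P _ xv); rewrite pv bformZr rd mulr0.
by rewrite pv bformZr => /eqP; rewrite mulf_eq0 (negPf k0) => /eqP.
Qed.

Lemma mu_vecZ x y r (k : F3) : k != 0 -> mu_vec x y r -> mu_vec x y (k *: r).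
Proof.
move=> k0 [N r0 P]; split; first by rewrite !bformE N !mulr0.
  by rewrite scaler_eq0 negb_or k0.
move=> c xc; apply: (iff_trans (P c xc)); rewrite bformZl.
by split=> [->|/eqP]; rewrite ?mulr0 // mulf_eq0 (negPf k0) => /eqP.
Qed.

Lemma mu_vec_common x y z r : nonadj x y -> e x z -> e z y -> mu_vec x y r ->
  <<p x z, r>>_x = 0 /\
  forall d, e x d /\ e z d -> (<<r, p x d>>_x = 0 <-> <<offset x z y, p z d>>_z = 0).
Proof.
move=> xy xz zy [Nr r0 P]; split; first by rewrite bformC //; apply/(P _ xz)/symE.
move=> d [xd zd]; apply: (iff_trans (iff_sym (P _ xd))).
exact: (offset_common xz xy zy).
Qed.

(** * Twins, realisation of isotropic vectors, and diameter 2 *)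

Definition same_nbrs x y t := forall c, e x c -> (e y c <-> e t c).

(** Both isotropic vectors are orthogonal to [p x z] and have the same orthogonal points in its
    complement, hence are proportional. *)
Lemma same_nbrs_local x y t z : nonadj x y -> nonadj x t -> e x z -> e z y -> e z t ->
  (forall d, e x d -> e z d -> (e y d <-> e t d)) -> same_nbrs x y t.
Proof.
move=> xy xt xz zy zt loc.
have [r mr] := mu_vec_exists xy xz (symE zy); have [q mq] := mu_vec_exists xt xz (symE zt).
have [zr _] := mu_vec_common xy xz zy mr; have [zq _] := mu_vec_common xt xz zt mq.
case: (mr) (mq) => Nr r0 Pr [Nq q0 Pq].
have [|||||k k0 qE] := @isotropic_unique _ _ (symB x) (uB x) [:: p x z] r q _ _ Nr Nq q0.
- by rewrite /orthogonal_seq /= (Np xz).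
- exact: leq_trans (n6 x).
- by rewrite /perp /= zr eqxx.
- by rewrite /perp /= zq eqxx.
- move=> d Nd; rewrite /perp /= andbT => /eqP zd rd.
  have [v xv [k k0 pv]] := repr_onto (rp x) Nd isT.
  have zv : e z v by apply/(adj xz xv); rewrite pv bformZr zd mulr0.
  have /(Pq _ xv) : e t v by apply/(loc _ xv zv)/(Pr _ xv); rewrite pv bformZr rd mulr0.
  by rewrite pv bformZr => /eqP; rewrite mulf_eq0 (negPf k0) => /eqP.
move=> c xc; apply: (iff_trans (Pr _ xc)); apply: iff_sym; apply: (iff_trans (Pq _ xc)).
rewrite qE bformZl.
by split=> [/eqP|->]; rewrite ?mulr0 // mulf_eq0 (negPf k0) => /eqP.
Qed.

Definition twin x y t := [/\ nonadj x t, t <> y & same_nbrs x y t].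

(** The two offsets have the same orthogonal points in the complement of [p z x], so they are
    proportional; factor 1 would identify [t] with [y]. *)
Lemma twin_offset x y t z : nonadj x y -> e x z -> e z y -> twin x y t ->
  e z t /\ offset x z t = - offset x z y.
Proof.
move=> xy xz zy [xt ty same]; have zt : e z t by apply/symE/(same _ xz)/symE.
split=> //; have [|||||k k0 oE] := @isotropic_unique _ _ (symB z) (uB z) [:: p z x] (offset x z y) (offset x z t)
  _ _ (offset_isotropic xz xy zy) (offset_isotropic xz xt zt) (offset_neq0 xz xt zt).
- by rewrite /orthogonal_seq /= (Np (symE xz)).
- exact: leq_trans (n6 z).
- by rewrite /perp /= offset_perp ?eqxx.
- by rewrite /perp /= offset_perp ?eqxx.
- move=> d Nd; rewrite /perp /= andbT => /eqP xd od.
  have [v zv [k k0 pv]] := repr_onto (rp z) Nd isT.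
  have xv : e x v by apply/(adj (symE xz) zv); rewrite pv bformZr xd mulr0.
  have : e t v by apply/(same _ xv)/(offset_common xz xy zy xv zv); rewrite pv bformZr od mulr0.
  move/(offset_common xz xt zt xv zv).
  by rewrite pv bformZr => /eqP; rewrite mulf_eq0 (negPf k0) => /eqP.
move: k k0 oE; elim/F3_elim => // _; last by rewrite scaleN1r.
by rewrite scale1r => /(offset_inj xz zt zy xt).
Qed.

Lemma twin_exists x y z : nonadj x y -> e x z -> e z y -> exists t, twin x y t.
Proof.
move=> xy xz zy.
have [|||t [xt zt ot]] := @offset_onto x z xz (- offset x z y).
- by rewrite oppr_eq0 offset_neq0.
- by rewrite bformNl bformNr opprK offset_isotropic.
- by rewrite bformNr offset_perp // oppr0.
exists t; split => //.
  move=> ty; move: ot (offset_neq0 xz xy zy); rewrite ty => /eqP; rewrite -subr_eq0 opprK.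
  by rewrite addrr_F3 oppr_eq0 => ->.
apply: (same_nbrs_local xy xt xz) => // d xd zd.
apply: (iff_trans (offset_common xz xy zy xd zd)); apply: iff_sym.
apply: (iff_trans (offset_common xz xt zt xd zd)); rewrite ot bformNl.
by split=> [/eqP|->]; rewrite ?oppr0 // oppr_eq0 => /eqP.
Qed.

(** The vector is transported to the space of a neighbour [z] orthogonal to it and realised there as
    an offset; uniqueness in the complement of [p x z] brings it back. *)
Lemma mu_vec_onto x r : <<r, r>>_x = 0 -> r != 0 ->
  exists2 y, nonadj x y & mu_vec x y r.
Proof.
move=> Nr r0; have [||d [Nd _]] := @exists_plus _ _ [::] [:: r] (symB x) (uB x) => //.
  exact: leq_trans (n6 x).
rewrite /perp /= andbT => /eqP rd.
have [z xz [k k0 pz]] := repr_onto (rp x) Nd isT; have zx := symE xz.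
have rz : <<p x z, r>>_x = 0 by rewrite bformC // pz bformZr rd mulr0.
have [s [Ns s0 xs sP]] := transport_isotropic (symB x) (symB z) (uB x) (uB z) (rich x)
  (Np xz) (Np zx) (repr_common xz) (repr_common' xz) Nr r0 rz.
have [y [xy zy oy]] := offset_onto xz s0 Ns xs.
have [q mq] := mu_vec_exists xy xz (symE zy); exists y => //.
have [zq qP] := mu_vec_common xy xz zy mq; case: (mq) => Nq q0 Pq.
have [|||||k' k'0 rE] := @isotropic_unique _ _ (symB x) (uB x) [:: p x z] q r _ _ Nq Nr r0.
- by rewrite /orthogonal_seq /= (Np xz).
- exact: leq_trans (n6 x).
- by rewrite /perp /= zq eqxx.
- by rewrite /perp /= rz eqxx.
- move=> c Nc; rewrite /perp /= andbT => /eqP zc qc.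
  have [v xv [l l0 pv]] := repr_onto (rp x) Nc isT.
  have zv : e z v by apply/(adj xz xv); rewrite pv bformZr zc mulr0.
  have : <<r, p x v>>_x = 0.
    by apply/(sP _ (conj xv zv)); rewrite -oy; apply/(qP _ (conj xv zv)); rewrite pv bformZr qc mulr0.
  by rewrite pv bformZr => /eqP; rewrite mulf_eq0 (negPf l0) => /eqP.
by rewrite rE; apply: mu_vecZ.
Qed.

(** Induction along a path: when [x] and [y] are at distance 2 and [w] is adjacent to [y], some
    neighbour of [y] orthogonal to the isotropic vector of the pair is adjacent to [w]. *)
Lemma diameter2 x y : connected_graph e -> [\/ y = x, e x y | nonadj x y /\ exists2 z, e x z & e z y].
Proof.
case=> _ conn; have [yx|yx] := pselect (y = x); first exact: Or31.
have [xy|xy] := pselect (e x y); first exact: Or32.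
apply: Or33; split=> //; have cxy := clos_rt_rtn1 _ _ _ _ (conn x y); move: yx xy.
elim: cxy => // {}y w yw _ IH wx xw.
have [yx|yx] := pselect (y = x); first by case: xw; rewrite -yx.
have [xy|xy] := pselect (e x y); first by exists y.
have [z xz zy] := IH yx xy; have yx' : nonadj y x by split=> [xy'|/symE //]; apply: yx.
have [s [Ns s0 Ps]] := mu_vec_exists yx' (symE zy) xz.
have [||d [Nd]] := @exists_plus _ _ [:: p y w] [:: s] (symB y) (uB y) => //.
- by rewrite /orthogonal_seq /= (Np yw).
- exact: leq_trans (n6 x).
rewrite /perp /= !andbT => /eqP wd /eqP sd; have [v yv [k k0 pv]] := repr_onto (rp y) Nd isT.
exists v; first by apply/(Ps _ yv); rewrite pv bformZr sd mulr0.
by apply/symE/(adj yw yv); rewrite pv bformZr wd mulr0.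
Qed.

(* The scalar product of the vectors attached to y and y' is read off adjacency to y and to its twin. *)
Definition twin_form x y y' : F3 :=
  if `[< e y y' >] then -1 else if `[< exists2 t, twin x y t & e t y' >] then 1 else 0.

(** Product -1 means adjacency to [y] and, the twin having the opposite offset, product 1 means
    adjacency to the twin. All common neighbours [z] thus give the same value. *)
Lemma twin_formE x y y' z : nonadj x y -> nonadj x y' -> e x z -> e z y -> e z y' ->
  twin_form x y y' = <<offset x z y, offset x z y'>>_z.
Proof.
move=> xy xy' xz zy zy'; rewrite /twin_form.
case: asboolP => [/(offset_adj xz xy xy' zy zy') -> //|yy'].
case: asboolP => [[t ty ty']|nty].
  have [zt ot] := twin_offset xy xz zy ty; case: ty => xt _ _.
  by move/(offset_adj xz xt xy' zt zy'): ty'; rewrite ot bformNl; f3.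
have [t ty] := twin_exists xy xz zy; have [zt ot] := twin_offset xy xz zy ty.
have nt : ~ e t y' by move=> ty'; apply: nty; exists t.
case: (ty) => xt _ _; have h1 := offset_adj xz xy xy' zy zy'.
have h2 := offset_adj xz xt xy' zt zy'; rewrite ot bformNl in h2.
move: h1 h2; elim/F3_elim: <<_, _>>_z => // [[_ h1] [_ h2]|[_ h1] _].
  by case: nt; apply: h2.
by case: yy'; apply: h1.
Qed.

(** * Choosing signs for the isotropic vectors *)

Section Signs.
Variables (x : V) (r : V -> 'rV[F3]_n).
Hypothesis rP : forall y, nonadj x y -> mu_vec x y (r y).

Notation "y _|/ y'" := (<<r y, r y'>>_x != 0) (at level 70, y' at next level).

Let Nr y : nonadj x y -> <<r y, r y>>_x = 0. Proof. by case/rP. Qed.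
Let r0 y : nonadj x y -> r y != 0. Proof. by case/rP. Qed.

Lemma vertex_perp y v (k : F3) d : nonadj x y -> e x v -> p x v = k *: d -> <<r y, d>>_x = 0 -> e v y.
Proof.
by move=> xy xv pv yd; case: (rP xy) => _ _ P; apply/symE/(P _ xv); rewrite pv bformZr yd mulr0.
Qed.

Lemma common_nbr2 y y' : nonadj x y -> nonadj x y' -> exists z, [/\ e x z, e z y & e z y'].
Proof.
move=> xy xy'; have [||d [Nd _]] := @exists_plus _ _ [::] [:: r y; r y'] (symB x) (uB x) => //.
  exact: n6 x.
rewrite /perp /= andbT => /andP[/eqP yd /eqP y'd].
have [v xv [k k0 pv]] := repr_onto (rp x) Nd isT.
by exists v; split=> //; apply: vertex_perp pv _.
Qed.

Lemma common_nbr3 y1 y2 y3 : nonadj x y1 -> nonadj x y2 -> nonadj x y3 ->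
  y1 _|/ y2 -> y2 _|/ y3 -> y1 _|/ y3 -> exists z, [/\ e x z, e z y1, e z y2 & e z y3].
Proof.
move=> Y1 Y2 Y3 n12 n23 n13.
have [|d [Nd d1 d2 d3]] := exists_plus_perp3 (symB x) (uB x) _ (Nr Y1) (Nr Y2) (Nr Y3) n12 n23 n13.
  exact: leq_trans (n6 x).
have [v xv [k k0 pv]] := repr_onto (rp x) Nd isT.
by exists v; split=> //; apply: vertex_perp pv _.
Qed.

Lemma twin_formC y y' : nonadj x y -> nonadj x y' -> twin_form x y y' = twin_form x y' y.
Proof.
move=> xy xy'; have [z [xz zy zy']] := common_nbr2 xy xy'.
by rewrite (twin_formE xy xy' xz zy zy') (twin_formE xy' xy xz zy' zy); exact: bformC.
Qed.

Lemma twin_form_triple y1 y2 y3 z : nonadj x y1 -> nonadj x y2 -> nonadj x y3 ->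
  e x z -> e z y1 -> e z y2 -> e z y3 -> y1 _|/ y2 ->
  twin_form x y1 y2 != 0 /\
  (<<r y1, r y3>>_x = <<r y1, r y2>>_x * <<r y2, r y3>>_x <->
   twin_form x y1 y3 = twin_form x y1 y2 * twin_form x y2 y3).
Proof.
move=> Y1 Y2 Y3 xz z1 z2 z3 n12; rewrite (twin_formE Y1 Y2 xz z1 z2) (twin_formE Y1 Y3 xz z1 z3) (twin_formE Y2 Y3 xz z2 z3).
have [zr1 R1] := mu_vec_common Y1 xz z1 (rP Y1).
have [zr2 R2] := mu_vec_common Y2 xz z2 (rP Y2).
have [_ R3] := mu_vec_common Y3 xz z3 (rP Y3).
exact: (transport_triple (symB x) (symB z) (uB z) (rich z) (Np (symE xz)) (repr_common xz)
  (repr_common' xz) (Nr Y1) (Nr Y2) (offset_isotropic xz Y1 z1) (offset_isotropic xz Y2 z2)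
  zr1 zr2 (offset_perp xz Y1 z1) (offset_perp xz Y2 z2) R1 R2 R3 n12).
Qed.

Lemma twin_form_eq0 y y' : nonadj x y -> nonadj x y' ->
  (twin_form x y y' == 0) = (<<r y, r y'>>_x == 0).
Proof.
move=> xy xy'; have [z [xz zy zy']] := common_nbr2 xy xy'.
apply/idP/idP; apply: contraTT => nz; first by case: (twin_form_triple xy xy' xy xz zy zy' zy nz).
have [zr R] := mu_vec_common xy xz zy (rP xy).
have [zr' R'] := mu_vec_common xy' xz zy' (rP xy').
rewrite (twin_formE xy xy' xz zy zy') in nz.
(* The converse transports from the space of [z] to that of [x]. *)
by have [] := transport_triple (symB z) (symB x) (uB x) (rich x) (Np xz) (repr_common' xz)
  (repr_common xz) (offset_isotropic xz xy zy) (offset_isotropic xz xy' zy')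
  (Nr xy) (Nr xy') (offset_perp xz xy zy) (offset_perp xz xy' zy') zr zr'
  (fun d Xd => iff_sym (R d Xd)) (fun d Xd => iff_sym (R' d Xd)) (fun d Xd => iff_sym (R d Xd)) nz.
Qed.

(* The sign by which the form read off the graph differs from that of r y and r y'; it is a cocycle. *)
Let sgn y y' := twin_form x y y' * <<r y, r y'>>_x.

Lemma sgnC y y' : nonadj x y -> nonadj x y' -> sgn y y' = sgn y' y.
Proof. by move=> xy xy'; rewrite /sgn twin_formC // bformC. Qed.

Lemma sgn_neq0 y y' : nonadj x y -> nonadj x y' -> y _|/ y' -> sgn y y' != 0.
Proof. by move=> xy xy' nz; rewrite /sgn mulf_neq0 // twin_form_eq0. Qed.

(** All six products are 1 or -1, so the equivalence of the two multiplicative relations makes the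
    two products around the triangle equal. *)
Lemma sgn_triple y1 y2 y3 : nonadj x y1 -> nonadj x y2 -> nonadj x y3 ->
  y1 _|/ y2 -> y2 _|/ y3 -> y1 _|/ y3 -> sgn y1 y3 = sgn y1 y2 * sgn y2 y3.
Proof.
move=> Y1 Y2 Y3 n12 n23 n13; have [z [xz z1 z2 z3]] := common_nbr3 Y1 Y2 Y3 n12 n23 n13.
have [_ [h1 h2]] := twin_form_triple Y1 Y2 Y3 xz z1 z2 z3 n12.
have : (<<r y1, r y3>>_x == <<r y1, r y2>>_x * <<r y2, r y3>>_x) =
    (twin_form x y1 y3 == twin_form x y1 y2 * twin_form x y2 y3) by apply/eqP/eqP.
have t12 : twin_form x y1 y2 != 0 by rewrite twin_form_eq0.
have t23 : twin_form x y2 y3 != 0 by rewrite twin_form_eq0.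
have t13 : twin_form x y1 y3 != 0 by rewrite twin_form_eq0.
rewrite /sgn; case: (F3_neq0 n12) => ->; case: (F3_neq0 n23) => ->; case: (F3_neq0 n13) => ->;
case: (F3_neq0 t12) => ->; case: (F3_neq0 t23) => ->; case: (F3_neq0 t13) => ->; clear; f3.
Qed.

Lemma vertex_meeting c : <<c, c>>_x = 0 -> c != 0 ->
  exists2 a, nonadj x a & forall q, (<<q, r a>>_x == 0) = (<<q, c>>_x == 0).
Proof.
move=> Nc c0; have [a xa ma] := mu_vec_onto Nc c0; exists a => // q.
have [k k0 rE] := mu_vec_unique ma (rP xa); rewrite rE bformZr mulf_eq0.
by rewrite (negPf k0).
Qed.

(** The sign at [y] is read from the base vertex [y0], directly or along a path [y], [a], [y0] of
    nonorthogonal vectors. Triangles identify the paths through nonorthogonal midpoints; orthogonal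
    midpoints are linked by a third one. *)
Lemma sgn_coboundary : exists s : V -> F3, forall y, nonadj x y -> s y != 0 /\
  forall y', nonadj x y' -> y _|/ y' -> sgn y y' = s y * s y'.
Proof.
have [[y0 Y0]|no] := pselect (exists y0, nonadj x y0); last first.
  by exists (fun=> 1) => y xy; case: no; exists y.
have npC a b : a _|/ b -> b _|/ a by rewrite bformC.
have c0 c q : <<q, c>>_x != 0 -> c != 0 by apply: contraNneq => ->; rewrite bform0r.
have /choice[s sP] y : exists s, nonadj x y -> [/\ s != 0, y _|/ y0 -> s = sgn y y0 &
    forall a, nonadj x a -> a _|/ y0 -> a _|/ y -> s = sgn y a * sgn a y0].
  have [xy|nxy] := pselect (nonadj x y); last by exists 0.
  have [yy0|ny] := eqVneq <<r y0, r y>>_x 0; last first.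
    exists (sgn y y0) => _; split; [exact: sgn_neq0 xy Y0 (npC _ _ ny)|by []|].
    by move=> a xa ay0 ay; exact: sgn_triple xy xa Y0 (npC _ _ ay) ay0 (npC _ _ ny).
  have [b Nb [b0 by_]] := exists_isotropic_meeting2 (symB x) (uB x) (Nr Y0) (Nr xy) (r0 Y0) (r0 xy) yy0.
  have [a xa aE] := vertex_meeting Nb (c0 _ _ b0).
  have ay0 : a _|/ y0 by apply: npC; rewrite aE.
  have ay : a _|/ y by apply: npC; rewrite aE.
  exists (sgn y a * sgn a y0) => _; split.
  - by apply: mulf_neq0; [exact: sgn_neq0 xy xa (npC _ _ ay)|exact: sgn_neq0 xa Y0 ay0].
  - by rewrite bformC // yy0 eqxx.
  have close b1 b2 : nonadj x b1 -> nonadj x b2 -> b1 _|/ b2 -> b1 _|/ y0 -> b1 _|/ y ->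
      b2 _|/ y0 -> b2 _|/ y -> sgn y b1 * sgn b1 y0 = sgn y b2 * sgn b2 y0.
    move=> X1 X2 n12 n10 n1y n20 n2y.
    rewrite (sgn_triple xy X1 X2 (npC _ _ n1y) n12 (npC _ _ n2y)) (sgn_triple X1 X2 Y0 n12 n20 n10).
    by rewrite mulrA.
  move=> b' xb' b'y0 b'y; have [ab'|] := eqVneq <<r a, r b'>>_x 0; last by move=> nab'; exact: close.
  have [c Nc [n0 ny na nb]] := exists_isotropic_link (symB x) (uB x) (n6 x) (Nr Y0) (Nr xy) (Nr xa) (Nr xb')
    yy0 ab' (npC _ _ ay0) (npC _ _ ay) (npC _ _ b'y0).
  have [d xd dE] := vertex_meeting Nc (c0 _ _ n0).
  have dy0 : d _|/ y0 by apply: npC; rewrite dE.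
  have dy : d _|/ y by apply: npC; rewrite dE.
  have ad : a _|/ d by rewrite dE.
  have b'd : b' _|/ d by rewrite dE.
  by rewrite (close _ _ xa xd ad ay0 ay dy0 dy) (close _ _ xb' xd b'd b'y0 b'y dy0 dy).
exists s => y xy; have [s0 sy sa] := sP y xy; split=> // y' xy' yy'.
have [_ sy' sa'] := sP y' xy'; have y'y := npC _ _ yy'.
have sq b1 b2 : nonadj x b1 -> nonadj x b2 -> b1 _|/ b2 -> sgn b1 b2 * sgn b1 b2 = 1.
  by move=> X1 X2 /(sgn_neq0 X1 X2); move: (sgn _ _); f3.
have [ny|yy0] := boolP (y _|/ y0).
  by rewrite (sa' y xy ny yy') (sy ny) (sgnC xy' xy) mulrCA (sq _ _ xy Y0 ny) mulr1.
have [ny'|y'y0] := boolP (y' _|/ y0).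
  by rewrite (sa y' xy' ny' y'y) (sy' ny') -mulrA (sq _ _ xy' Y0 ny') mulr1.
rewrite negbK in yy0; rewrite negbK in y'y0.
(* Neither vertex meets [y0]: one [d] meeting all three is the midpoint of both paths. *)
have [c Nc [n0 ny ny']] := exists_isotropic_meeting3 (symB x) (uB x) (Nr xy) (Nr xy') (Nr Y0) (r0 Y0) yy'
  (etrans (bformC (symB x) _ _) (eqP yy0)) (etrans (bformC (symB x) _ _) (eqP y'y0)).
have [d xd dE] := vertex_meeting Nc (c0 _ _ n0).
have dy0 : d _|/ y0 by apply: npC; rewrite dE.
have yd : y _|/ d by rewrite dE.
have y'd : y' _|/ d by rewrite dE.
rewrite (sa d xd dy0 (npC _ _ yd)) (sa' d xd dy0 (npC _ _ y'd)) (sgnC xy' xd).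
by rewrite (sgn_triple xy xd xy' yd (npC _ _ y'd) yy') [RHS]mulrACA (sq _ _ xd Y0 dy0) mulr1.
Qed.

Lemma lift_exists : exists f : V -> 'rV[F3]_n, forall y, nonadj x y ->
  mu_vec x y (f y) /\ forall y', nonadj x y' -> <<f y, f y'>>_x = twin_form x y y'.
Proof.
have [s sP] := sgn_coboundary; exists (fun y => s y *: r y) => y xy.
have [s0 sE] := sP y xy; split; first exact: mu_vecZ s0 (rP xy).
move=> y' xy'; rewrite bformZl bformZr mulrA; have [rr'|nrr'] := eqVneq <<r y, r y'>>_x 0.
  by rewrite rr' mulr0; apply/esym/eqP; rewrite twin_form_eq0 // rr' eqxx.
rewrite -(sE _ xy' nrr') /sgn -mulrA; case: (F3_neq0 nrr') => ->; move: (twin_form x y y'); f3.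
Qed.

End Signs.

(** * Reconstruction of the model around a vertex *)

Lemma twin_form_inj x y y' a : nonadj x y -> nonadj x y' -> nonadj x a ->
  (exists z, [/\ e x z, e z y & e z a]) -> twin_form x y a != 0 ->
  same_nbrs x y y' -> twin_form x y a = twin_form x y' a -> y = y'.
Proof.
move=> xy xy' xa [z [xz zy za]] nz same eqf; apply: contrapT => yy'.
(* Twins have opposite offsets, hence opposite products with [a], and these are nonzero. *)
have tw : twin x y y' by split=> // y'y; apply: yy'.
have [zy' oy'] := twin_offset xy xz zy tw; move: nz.
rewrite (twin_formE xy xa xz zy za) (twin_formE xy' xa xz zy' za) oy' bformNl in eqf *.
by move: eqf; f3.
Qed.

Lemma recognition x : connected_graph e -> exists (p' : V -> 'rV[F3]_(1 + n)),
  represents e (fun _ => True) (block_mx 1%:M 0 0 (B x)) [::] p'.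
Proof.
move=> conn; set B' := block_mx _ _ _ _.
have tri y := diameter2 x y conn.
have nonadj_nbr y : nonadj x y -> exists2 z, e x z & e z y.
  by move=> [yx xy]; case: (tri y) => // -[].
have /choice[r rP] y : exists r, nonadj x y -> mu_vec x y r.
  have [xy|nxy] := pselect (nonadj x y); last by exists 0.
  have [z xz zy] := nonadj_nbr y xy; have [r mr] := mu_vec_exists xy xz (symE zy).
  by exists r.
have [f fP] := lift_exists rP.
(* The vertex [x] becomes the first unit vector, neighbours keep their vectors in the space of [x],
   and vertices at distance 2 become the first unit vector plus their lifted isotropic vector. *)
pose p' y : 'rV[F3]_(1 + n) := if `[< y = x >] then row_mx 1%:M 0
  else if `[< e x y >] then row_mx 0 (p x y) else row_mx 1%:M (f y).
have p'x : p' x = row_mx 1%:M 0 by rewrite /p'; case: asboolP.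
have p'n y : e x y -> p' y = row_mx 0 (p x y).
  move=> xy; rewrite /p'; case: asboolP => [yx|_]; last by case: asboolP.
  by case: (@irrE x); move: xy; rewrite yx.
have p'f y : nonadj x y -> p' y = row_mx 1%:M (f y).
  by case=> yx xy; rewrite /p'; case: asboolP => // _; case: asboolP.
have formE (c d : F3) u v : bform B' (row_mx c%:M u) (row_mx d%:M v) = c * d + <<u, v>>_x.
  rewrite /bform /B' mul_row_block !mulmx0 addr0 add0r mulmx1 tr_row_mx mul_row_col mxE.
  by rewrite tr_scalar_mx -scalar_mxM !mxE.
have form1 u v : bform B' (row_mx 1%:M u) (row_mx 1%:M v) = 1 + <<u, v>>_x by rewrite formE mulr1.
have scalar0 : (0 : F3)%:M = 0 :> 'M[F3]_1 by exact: raddf0.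
have form01 u v : bform B' (row_mx 0 u) (row_mx 1%:M v) = <<u, v>>_x.
  by rewrite -scalar0 formE mul0r add0r.
have form10 u v : bform B' (row_mx 1%:M u) (row_mx 0 v) = <<u, v>>_x.
  by rewrite -scalar0 formE mulr0 add0r.
have form0 u v : bform B' (row_mx 0 u) (row_mx 0 v) = <<u, v>>_x.
  by rewrite -scalar0 formE mulr0 add0r.
have Nf y : nonadj x y -> <<f y, f y>>_x = 0 by move=> /fP[[]].
have f0 y : nonadj x y -> f y != 0 by move=> /fP[[]].
have same y y' (k : F3) : nonadj x y -> nonadj x y' -> k != 0 -> f y' = k *: f y -> same_nbrs x y y'.
  move=> xy xy' k0 ff' c xc; have [[_ _ P] _] := fP y xy; have [[_ _ P'] _] := fP y' xy'.
  apply: (iff_trans (P _ xc)); apply: iff_sym; apply: (iff_trans (P' _ xc)); rewrite ff' bformZl.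
  by split=> [/eqP|->]; rewrite ?mulr0 // mulf_eq0 (negPf k0) => /eqP.
have f_inj y y' : nonadj x y -> nonadj x y' -> f y = f y' -> y = y'.
  move=> xy xy' ff'; have Nfy := Nf y xy; have fy0 := f0 y xy.
  have [b Nb [yb _]] := exists_isotropic_meeting2 (symB x) (uB x) Nfy Nfy fy0 fy0 Nfy.
  have b0 : b != 0 by apply: contraNneq yb => ->; rewrite bform0r.
  have [a xa ma] := mu_vec_onto Nb b0; have [k k0 fa] := mu_vec_unique ma (fP a xa).1.
  have formE' y1 : nonadj x y1 -> twin_form x y1 a = <<f y1, f a>>_x by move=> xy1; rewrite (fP y1 xy1).2.
  apply: (@twin_form_inj x y y' a xy xy' xa).
  - by have [z [xz zy za]] := common_nbr2 rP xy xa; exists z.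
  - by rewrite formE' // fa bformZr mulf_neq0.
  - by apply: (same y y' 1) => //; rewrite scale1r.
  - by rewrite !formE' // ff'.
have f_onto u : <<u, u>>_x = 0 -> u != 0 -> exists2 y, nonadj x y & f y = u.
  move=> Nu u0; have [y xy my] := mu_vec_onto Nu u0.
  have [k k0 fy] := mu_vec_unique my (fP y xy).1.
  case: (F3_neq0 k0) => kE; first by exists y => //; rewrite fy kE scale1r.
  have [z xz zy] := nonadj_nbr y xy; have [t [xt ty st]] := twin_exists xy xz zy.
  have mt : mu_vec x t u.
    case: my => _ _ P; split=> // c xc; apply: iff_trans (P c xc); apply: iff_sym; exact: st.
  have [l l0 ft] := mu_vec_unique mt (fP t xt).1; exists t => //.
  case: (F3_neq0 l0) => lE; first by rewrite ft lE scale1r.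
  (* If [y] and its twin both mapped to [- u], injectivity would identify them. *)
  by case: ty; apply: f_inj => //; rewrite ft fy lE kE.
have one_scale (k l : F3) : k%:M = l *: 1%:M :> 'M[F3]_1 -> k = l.
  by move/matrixP/(_ 0 0); rewrite !mxE /= !mulr1n mulr1.
have p0 y : e x y -> p x y != 0.
  by move=> xy; apply/eqP => h; have := Np xy; rewrite h bform0l => /eqP.
exists p'; split => //.
- move=> y _; case: (tri y) => [->|xy|[xy _]].
  + by rewrite p'x form1 bform0l addr0.
  + by rewrite p'n // form0 Np.
  + by rewrite p'f // form1 Nf // addr0.
- move=> c; rewrite -(hsubmxK c) (mx11_scalar (lsubmx c)).
  move: (lsubmx c 0 0) (rsubmx c) => k u; rewrite formE => Nc _.
  (* First coordinate 0 gives the neighbours of [x]; otherwise scaling by [k] makes that coordinate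
     1. *)
  have [k0|k0] := eqVneq k 0.
    have [||v xv [l l0 pv]] := @repr_onto _ _ _ _ _ _ _ (rp x) u => //.
      by rewrite -Nc k0 mul0r add0r.
    exists v => //; exists l => //; rewrite p'n // pv scale_row_mx k0.
    by rewrite scalar0 scaler0.
  have kk : k * k = 1 by move: k0; clear; move: k; f3.
  have Nu : <<u, u>>_x = 0 by move: Nc; rewrite kk; f3.
  have kE : k *: k%:M = 1%:M :> 'M[F3]_1 by rewrite scale_scalar_mx kk.
  have [u0|u0] := eqVneq u 0.
    by exists x => //; exists k => //; rewrite p'x scale_row_mx kE u0 scaler0.
  have [||y xy fy] := f_onto (k *: u); first by rewrite !bformE Nu !mulr0.
    by rewrite scaler_eq0 negb_or k0.
  by exists y => //; exists k => //; rewrite p'f // scale_row_mx kE fy.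
- move=> v w k _ _.
  have zero_scale (l : F3) : 0 = l *: 1%:M :> 'M[F3]_1 -> l = 0.
    by rewrite -scalar0 => /one_scale.
  case: (tri v) => [->|/[dup] xv /p'n ->|[/[dup] xv /p'f -> _]];
    case: (tri w) => [->|/[dup] xw /p'n ->|[/[dup] xw /p'f -> _]] //;
    rewrite ?p'x scale_row_mx => /eq_row_mx[].
  + by move=> /matrixP/(_ 0 0); rewrite scaler0 !mxE => /eqP.
  + by move=> /one_scale <- /esym/eqP; rewrite scale1r (negPf (f0 w xw)).
  + by move=> _ /eqP; rewrite scaler0 (negPf (p0 v xv)).
  + by move=> _; exact: (repr_inj (rp x)).
  + by move=> /zero_scale -> /eqP; rewrite scale0r (negPf (p0 v xv)).
  + by move=> _ /eqP; rewrite scaler0 (negPf (f0 v xv)).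
  + by move=> /matrixP/(_ 0 0); rewrite scaler0 !mxE => /eqP.
  + by move=> /one_scale <-; rewrite scale1r => /f_inj; apply.
(* This sum vanishes exactly when [twin_form] is -1, its value on adjacent vertices. *)
- have key v w : nonadj x v -> nonadj x w -> e v w <-> 1 + <<f v, f w>>_x = 0.
    move=> xv xw; rewrite (fP v xv).2 // /twin_form; case: asboolP => [vw|nvw].
      by split=> // _; f3.
    by split=> // /eqP; case: asboolP.
  have mix v w : e x v -> nonadj x w -> e w v <-> <<f w, p x v>>_x = 0.
    by move=> xv xw; have [[_ _ P] _] := fP w xw; exact: P.
  have symI v w : e v w <-> e w v by split=> /symE.
  move=> v w _ _; case: (tri v) => [->|/[dup] xv /p'n ->|[/[dup] xv /p'f -> _]];
    case: (tri w) => [->|/[dup] xw /p'n ->|[/[dup] xw /p'f -> _]];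
    rewrite ?p'x ?form0 ?form01 ?form10 ?form1 ?bform0l ?bform0r.
  + by rewrite addr0; split=> [/irrE|/eqP].
  + by split.
  + by case: xw => _ nxw; rewrite addr0; split=> [//|/eqP].
  + by split=> // _; exact: symE.
  + exact: adj.
  + by apply: (iff_trans (symI _ _)); rewrite bformC //; exact: mix.
  + by case: xv => _ nxv; rewrite addr0; split=> [/symE//|/eqP].
  + exact: mix.
  + exact: key.
Qed.

End LocallySigma.

Theorem mainTheorem1 (eps : int) (n : nat)
  (Heps : (eps = 1%Z /\ (6 <= n)%N) \/ (eps = (-1)%Z /\ (7 <= n)%N))
  (V : Type) (e : V -> V -> Prop)
  (Hsimple : simple_graph e) (Hconn : connected_graph e)
  (Hloc : forall v : V, iso_Sigma (@nbhd_adj V e v) eps n) :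
  iso_Sigma e eps n.+1.
Proof.
case: Hsimple => symE irrE.
have /choice[B BP] v : exists B : 'M[F3]_n, good_form eps B /\ exists p, represents e (e v) B [::] p.
  by have [B [gB isoB]] := Hloc v; exists B; split=> //; exact: iso_repr_nbhd isoB.
have /choice[p rp] v : exists p, represents e (e v) (B v) [::] p by case: (BP v).
have symB v : (B v)^T = B v by have [[]] := BP v.
have detB v : \det (B v) = eps%:~R by have [[]] := BP v.
have uB v : B v \in unitmx.
  by rewrite unitmxE detB unitfE; case: Heps => -[-> _].
have rich v : rich_form (B v).
  case: Heps => -[epsE]; last by left.
  rewrite leq_eqVlt => /orP[/eqP n6|]; last by left.
  by right; split=> //; rewrite detB epsE.
have [[x] _] := Hconn.
have [p' rp'] := recognition symE irrE symB uB rich rp x Hconn.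
(* Adjoining an orthogonal vector of norm 1 preserves the discriminant. *)
pose B' : 'M[F3]_(1 + n) := block_mx 1%:M 0 0 (B x).
have symB' : B'^T = B' by rewrite tr_block_mx !trmx0 trmx1 symB.
have detB' : \det B' = eps%:~R by rewrite det_ublock det1 mul1r detB.
by exists B'; split; [split|exact: repr_iso rp'].
Qed.
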